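(* Let $m_*\ge2$. Suppose that $m_n\asymp(\log n)^{d_0}$ for a constant $d_0\in(0,1/2)$, and that, for $2\le m\le m_n$, $S_m$ satisfies Assumption A2(b) (with $\lambda=\lambda_m$, $\boldsymbol{K}=\boldsymbol{K}_m$) with projection dimension $s_m$. Let $\bar\alpha\in(0,1)$ and $c_{\bar\alpha}=-\log(-\log(1-\bar\alpha))$. Then, for any $\varepsilon>0$, there exist positive constants $C_\varepsilon,N_\varepsilon$ such that for any $n\ge N_\varepsilon$, with probability approaching $1$, $$\inf_{\substack{f\in\mathcal{B}_{n,m_*}\\ \|f\|_n\ge C_\varepsilon\delta(n,m_* )}}P_f(\tau_{n,m_n}\ge c_{\bar\alpha}\mid\boldsymbol{x},S)\ge1-\varepsilon,$$ where $\delta(n,m_* )=n^{-2m_*/(4m_*+1)}(\log\log n)^{m_*/(4m_*+1)}$, $\mathcal{B}_{n,m_*}=\{f\in\mathcal{H}_{m_*}:\frac1n\boldsymbol{f}^\top\boldsymbol{K}_{m_*}^{-1}\boldsymbol{f}\le1\}$ with $\boldsymbol{f}=(f(x_1),\dots,f(x_n))^\top$, and $P_f(\cdot\mid\boldsymbol{x},S)$ is the conditional probability under $f$ given $\boldsymbol{x}=(x_1,\dots,x_n)$ and the projection matrices.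
   Context: Model: $y_i=f(x_i)+\epsilon_i$, $i=1,\dots,n$, where $x_1,\dots,x_n$ are i.i.d. from a distribution $P_X$ on $\mathcal{X}\subseteq\mathbb{R}^d$ ($d\ge1$ fixed), $\epsilon_i$ are i.i.d. $N(0,1)$, independent of the $x_i$'s and of the projection matrices. $\boldsymbol{y}=(y_1,\dots,y_n)^\top$, $\|g\|_n^2=\frac1n\sum_ig(x_i)^2$. Kernels: for each integer $m\ge2$, $K_m$ is the reproducing kernel of an RKHS $\mathcal{H}_m\subset L^2(P_X)$ with expansion $K_m(x,x')=\sum_{i\ge1}\mu_i\phi_i(x)\phi_i(x')$ (eigenvalues and eigenfunctions depending on $m$), $\mu_1\ge\mu_2\ge\cdots$, $\{\phi_i\}$ a basis of $L^2(P_X)$ with $\langle\phi_i,\phi_j\rangle_{L^2(P_X)}=\delta_{ij}$, $\langle\phi_i,\phi_j\rangle_{\mathcal{H}_m}=\delta_{ij}/\mu_i$, which is a polynomial decay kernel of order $m$, i.e. $\mu_i\asymp i^{-2m}$, and satisfies Assumption A1: $\sup_i\|\phi_i\|_{\sup}<\infty$, $\sup_{k\ge1}\frac{\sum_{i>k}\mu_i}{k\mu_k}<\infty$. $\boldsymbol{K}_m=\frac1n[K_m(x_i,x_j)]_{1\le i,j\le n}$. The true regularity is $m_*$: $f\in\mathcal{H}_{m_*}$. Tuning: $\lambda_m=cn^{-4m/(4m+1)}(\log\log n)^{2m/(4m+1)}$ with a constant $c>0$; $S_m$ is an $s_m\times n$ random projection matrix, with $s_m$ an integer satisfying $s_m\ge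 dn^{2/(4m+1)}(\log\log n)^{-1/(4m+1)}$ for a sufficiently large constant $d>0$. Statistics: $\Delta_m=\boldsymbol{K}_mS_m^\top(S_m\boldsymbol{K}_m^2S_m^\top+\lambda_mS_m\boldsymbol{K}_mS_m^\top)^{-1}S_m\boldsymbol{K}_m$; $T_{n,m}=\frac1n\boldsymbol{y}^\top\Delta_m^2\boldsymbol{y}$; $\tau_m=\frac{nT_{n,m}-\mathrm{tr}(\Delta_m^2)}{\sqrt{2\,\mathrm{tr}(\Delta_m^4)}}$ for $2\le m\le m_n$; $\tau_n^*=\max_{2\le m\le m_n}\tau_m$; $\tau_{n,m_n}=B_n(\tau_n^*-B_n)$, where $B_n>0$ solves $2\pi B_n^2\exp(B_n^2)=m_n^2$. Assumption A2(b) for a matrix $S$ ($s\times n$), kernel matrix $\boldsymbol{K}$ and $\lambda$: let $\boldsymbol{K}=UDU^\top$ with $UU^\top=I_n$, $D=\mathrm{diag}(\widehat\mu_1\ge\cdots\ge\widehat\mu_n\ge0)$, $\widehat s_\lambda=\min\{i:\widehat\mu_i\le\lambda\}-1$, $s_\lambda=\min\{i:\mu_i\le\lambda\}-1$, $U=(U_1,U_2)$ with $U_1$ the first $\widehat s_\lambda$ columns, $D_2=\mathrm{diag}(\widehat\mu_{\widehat s_\lambda+1},\dots,\widehat\mu_n)$. $S$ is $\boldsymbol{K}$-satisfiable if there is a constant $c>0$ with $\|(SU_1)^\top SU_1-I_{\widehat s_\lambda}\|_{\mathrm{op}}\le1/2$ and $\|SU_2D_2^{1/2}\|_{\mathrm{op}}\le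 c\lambda^{1/2}$. An event $\mathcal{E}$ is of $(a,b)$-type, $a,b\in(0,\infty]$, if $P(P(\mathcal{E}\mid x_1,\dots,x_n)\ge1-e^{-a})\ge1-e^{-b}$. A2(b): there exist $c_1,c_2\in(0,\infty]$ such that ''$S$ is $\boldsymbol{K}$-satisfiable'' is of $(c_1s,c_2s_\lambda)$-type. *)

(* Defs.v *)
From HB Require Import structures.
From mathcomp Require Import all_boot all_order all_algebra.
From mathcomp Require Import all_classical all_reals all_analysis.

Set Implicit Arguments.
Unset Strict Implicit.
Unset Printing Implicit Defensive.

Import Order.TTheory GRing.Theory Num.Theory.
Import numFieldNormedType.Exports.

Local Open Scope classical_set_scope.
Local Open Scope ring_scope.

(* The input space is a subset X of R^d, with the trace of the Borel
   sigma-algebra.  Measurable types are pointed in the library, whence the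
   parameter x0; X is nonempty anyway as it carries a probability measure. *)
Definition pointed_subset (R : realType) (d : nat) (X : set (d.-tuple R))
  (x0 : X) : Type := X.

HB.instance Definition _ (R : realType) (d : nat) (X : set (d.-tuple R))
  (x0 : X) := Choice.on (pointed_subset x0).
HB.instance Definition _ (R : realType) (d : nat) (X : set (d.-tuple R))
  (x0 : X) := isPointed.Build (pointed_subset x0) x0.

Definition input_embed (R : realType) (d : nat) (X : set (d.-tuple R))
  (x0 : X) (x : pointed_subset x0) : d.-tuple R := val (x : X).

Notation input_space x0 := (g_sigma_algebra_preimageType (input_embed (x0 := x0))).

Section Probability.
Context {dO : measure_display} {Omega : measurableType dO} {R : realType}.
Variable P : probability Omega R.

(* Taking some of the A i to be setT gives the product rule for all
   subfamilies. *)
Definition mutually_independent d (T : measurableType d) (I : finType)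
    (X : I -> Omega -> T) : Prop :=
  forall A : I -> set T, (forall i, measurable (A i)) ->
    P (\bigcap_i (X i @^-1` A i)) = (\prod_i P (X i @^-1` A i))%E.

Definition independent_sigma (F G : set (set Omega)) : Prop :=
  forall A B, F A -> G B -> P (A `&` B) = (P A * P B)%E.

Definition is_cond_prob (G : set (set Omega)) (E : set Omega)
    (g : Omega -> R) : Prop :=
  (forall B : set R, measurable B -> G (g @^-1` B)) /\
  (forall D, G D -> (\int[P]_(w in D) (g w)%:E)%E = P (E `&` D)).

(* kappa is a regular conditional distribution of Y given G. *)
Definition is_cond_distribution d (T : measurableType d)
    (G : set (set Omega)) (Y : Omega -> T)
    (kappa : Omega -> probability T R) : Prop :=
  forall B : set T, measurable B ->
    is_cond_prob G (Y @^-1` B) (fun w => fine (kappa w B)).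

(* "E is of (a, b)-type", the inner conditional probability being taken given
   the sigma-algebra G.  All versions g agree almost surely. *)
Definition of_type (G : set (set Omega)) (E : set Omega) (a b : \bar R) :
    Prop :=
  measurable E /\
  exists2 g : Omega -> R, is_cond_prob G E g &
    (1 - expeR (- b) <= P [set w | 1 - expeR (- a) <= (g w)%:E])%E.

(* "E n holds with probability approaching 1"; E n need not be measurable. *)
Definition with_prob_approaching_1 (E : nat -> set Omega) : Prop :=
  exists A : nat -> set Omega,
    [/\ forall n, measurable (A n), forall n, A n `<=` E n &
        P (A n) @[n --> \oo] --> 1%E].

End Probability.

Section Asymptotics.
Context {R : realType}.

Definition asymp (u v : nat -> R) : Prop :=
  exists a b : R, [/\ 0 < a, 0 < b &
    \forall n \near \oo, a * v n <= u n <= b * v n].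

Definition loglog (n : nat) : R := ln (ln n%:R).

End Asymptotics.

Section Kernels.
Context {d : measure_display} {X : measurableType d} {R : realType}.

(* H is a Hilbert space of functions on X, with inner product ip, which is the
   RKHS of K; ip is only meaningful on H. *)
Record is_rkhs (K : X -> X -> R) (H : set (X -> R))
    (ip : (X -> R) -> (X -> R) -> R) : Prop := {
  rkhs0 : H (fun=> 0);
  rkhs_lin : forall (a : R) f g, H f -> H g -> H (fun x => a * f x + g x);
  rkhs_ip_lin : forall (a : R) f g h, H f -> H g -> H h ->
    ip (fun x => a * f x + g x) h = a * ip f h + ip g h;
  rkhs_ip_sym : forall f g, H f -> H g -> ip f g = ip g f;
  rkhs_ip_ge0 : forall f, H f -> 0 <= ip f f;
  rkhs_ip_eq0 : forall f, H f -> ip f f = 0 -> f = (fun=> 0);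
  rkhs_complete : forall u : nat -> X -> R, (forall i, H (u i)) ->
    (forall e : R, 0 < e -> exists N : nat, forall i j, (N <= i)%N ->
      (N <= j)%N -> ip (u i \- u j) (u i \- u j) < e) ->
    exists2 f, H f & ip (u i \- f) (u i \- f) @[i --> \oo] --> (0 : R);
  rkhs_kernel : forall x, H (K x);
  rkhs_reproducing : forall f x, H f -> ip f (K x) = f x }.

Definition orthonormal_basis_L2 (PX : probability X R) (phi : nat -> X -> R) :
    Prop :=
  [/\ forall i, phi i \in Lfun PX 2%:E,
      forall i j, (\int[PX]_x (phi i x * phi j x)%:E)%E = (i == j)%:R%:E &
      forall f : X -> R, f \in Lfun PX 2%:E ->
        exists a : nat -> R,
          (\int[PX]_x ((f x - \sum_(i < N) a i * phi i x) ^+ 2)%:E)%E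
            @[N --> \oo] --> 0%E].

(* Eigenvalues and eigenfunctions are numbered from 0: mu i and phi i stand for
   mu_{i+1} and phi_{i+1} of the usual numbering. *)
Record is_expansion (PX : probability X R) (K : X -> X -> R)
    (H : set (X -> R)) (ip : (X -> R) -> (X -> R) -> R)
    (mu : nat -> R) (phi : nat -> X -> R) : Prop := {
  expansion_nonincr : forall i, mu i.+1 <= mu i;
  expansion_basis : orthonormal_basis_L2 PX phi;
  expansion_in : forall i, H (phi i);
  expansion_ip : forall i j, ip (phi i) (phi j) = (i == j)%:R / mu i;
  expansion_kernel : forall x x',
    \sum_(i < N) mu i * phi i x * phi i x' @[N --> \oo] --> K x x' }.

Definition poly_decay (m : nat) (mu : nat -> R) : Prop :=
  asymp mu (fun i => (i.+1)%:R ^- (2 * m)%N).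

Definition regular_expansion (mu : nat -> R) (phi : nat -> X -> R) : Prop :=
  (exists M : R, forall i x, `|phi i x| <= M) /\
  (exists M : R, forall k : nat,
     (\sum_(k.+1 <= i <oo) (mu i)%:E <= (M * (k.+1%:R * mu k))%:E)%E).

Definition is_kernel_of_order (PX : probability X R) (m : nat)
    (K : X -> X -> R) (H : set (X -> R)) (ip : (X -> R) -> (X -> R) -> R)
    (mu : nat -> R) (phi : nat -> X -> R) : Prop :=
  [/\ is_rkhs K H ip, (forall f, H f -> f \in Lfun PX 2%:E),
      is_expansion PX K H ip mu phi, poly_decay m mu & regular_expansion mu phi].

Definition eval_vec (n : nat) (f : X -> R) (x : 'I_n -> X) : 'cV[R]_n :=
  \col_i f (x i).

Definition empirical_norm (n : nat) (f : X -> R) (x : 'I_n -> X) : R :=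
  Num.sqrt (n%:R^-1 * \sum_i f (x i) ^+ 2).

Definition kernel_mx (n : nat) (K : X -> X -> R) (x : 'I_n -> X) : 'M[R]_n :=
  \matrix_(i, j) (n%:R^-1 * K (x i) (x j)).

(* pinvmx is a generalised inverse, and invmx on invertible matrices.  When the
   kernel matrix is singular, the value of the quadratic form at the vector of
   values of a function of H does not depend on the generalised inverse. *)
Definition unit_ball (n : nat) (K : X -> X -> R) (H : set (X -> R))
    (x : 'I_n -> X) : set (X -> R) :=
  [set f | H f /\
    n%:R^-1 * ((eval_vec f x)^T *m pinvmx (kernel_mx K x) *m eval_vec f x) 0 0
      <= 1].

End Kernels.

Section Matrices.
Context {R : realType}.

Definition enorm (n : nat) (v : 'cV[R]_n) : R := Num.sqrt (\sum_i v i 0 ^+ 2).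

Definition opnorm (p q : nat) (A : 'M[R]_(p, q)) : R :=
  sup [set enorm (A *m v) | v in [set v : 'cV[R]_q | enorm v <= 1]].

(* With 0-based numbering, min {i >= 1 : mu_i <= lam} - 1 is the first index
   at which mu is <= lam; for a finite spectrum that stays above lam it is the
   number of eigenvalues. *)
Definition s_cutoff (mu : nat -> R) (lam : R) : nat :=
  xget 0%N [set k | mu k <= lam /\ forall j, (j < k)%N -> lam < mu j].

Definition s_cutoff_emp (n : nat) (mu : 'rV[R]_n) (lam : R) : nat :=
  find (fun i => mu 0 i <= lam) (enum 'I_n).

(* Right multiplication by pid_mx : 'M_(n, k), resp. by tail_mx n k, keeps the
   first k columns, resp. the last n - k columns (for k <= n). *)
Definition tail_mx (n k : nat) : 'M[R]_(n, n - k) :=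
  \matrix_(i, j) ((i : nat) == (k + j)%N)%:R.

Definition is_eigendecomposition (n : nat) (K U : 'M[R]_n) (mu : 'rV[R]_n) :
    Prop :=
  [/\ U *m U^T = 1%:M, forall i j : 'I_n, (i <= j)%N -> mu 0 j <= mu 0 i,
      forall i, 0 <= mu 0 i & K = U *m diag_mx mu *m U^T].

(* The two norms do not depend on the choice of the eigendecomposition. *)
Definition satisfiable (c lam : R) (s n : nat) (K : 'M[R]_n)
    (S : 'M[R]_(s, n)) : Prop :=
  exists (U : 'M[R]_n) (mu : 'rV[R]_n),
    is_eigendecomposition K U mu /\
    let k := s_cutoff_emp mu lam in
    let U1 : 'M[R]_(n, k) := U *m pid_mx k in
    let U2 := U *m tail_mx n k in
    let sqrtD2 := diag_mx (map_mx Num.sqrt (mu *m tail_mx n k)) in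
    opnorm ((S *m U1)^T *m (S *m U1) - 1%:M) <= 2^-1 /\
    opnorm (S *m U2 *m sqrtD2) <= c * Num.sqrt lam.

(* pinvmx is invmx whenever the inverted matrix is invertible; otherwise, for
   K positive semidefinite and lam > 0, Delta does not depend on the choice of
   the generalised inverse. *)
Definition Delta (lam : R) (s n : nat) (K : 'M[R]_n) (S : 'M[R]_(s, n)) :
    'M[R]_n :=
  K *m S^T *m pinvmx (S *m K *m K *m S^T + lam *: (S *m K *m S^T))
    *m S *m K.

Definition stat_T (n : nat) (D : 'M[R]_n) (y : 'cV[R]_n) : R :=
  n%:R^-1 * (y^T *m D ^+ 2 *m y) 0 0.

Definition stat_tau (n : nat) (D : 'M[R]_n) (y : 'cV[R]_n) : R :=
  (n%:R * stat_T D y - \tr (D ^+ 2)) / Num.sqrt (2 * \tr (D ^+ 4)).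

(* For mn >= 2, the unit of the iterated maximum is one of its terms. *)
Definition stat_max (mn : nat) (tau : nat -> R) : R :=
  \big[Num.max/tau 2%N]_(2 <= m < mn.+1) tau m.

Definition stat_adaptive (B : R) (mn : nat) (tau : nat -> R) : R :=
  B * (stat_max mn tau - B).

Definition lambda_seq (c : R) (m n : nat) : R :=
  c * n%:R `^ (- ((4 * m)%N%:R / (4 * m + 1)%N%:R))
    * loglog n `^ ((2 * m)%N%:R / (4 * m + 1)%N%:R).

Definition s_lower (m n : nat) : R :=
  n%:R `^ (2 / (4 * m + 1)%N%:R) * loglog n `^ (- (1 / (4 * m + 1)%N%:R)).

Definition delta_rate (m n : nat) : R :=
  n%:R `^ (- ((2 * m)%N%:R / (4 * m + 1)%N%:R))
    * loglog n `^ (m%:R / (4 * m + 1)%N%:R).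

End Matrices.

Section Model.
Context {dO : measure_display} {Omega : measurableType dO} {R : realType}.
Context {d : measure_display} {X : measurableType d}.
Variable P : probability Omega R.

Definition iid_with_law dT (T : measurableType dT) (Q : set T -> \bar R)
    (I : finType) (Y : I -> {RV P >-> T}) : Prop :=
  mutually_independent P Y /\
  forall i (A : set T), measurable A -> distribution P (Y i) A = Q A.

Definition sample (n : nat) (x : 'I_n -> {RV P >-> X}) (w : Omega) : 'I_n -> X :=
  fun i => x i w.

Definition random_mx (s n : nat) (S : 'I_s -> 'I_n -> {RV P >-> R})
    (w : Omega) : 'M[R]_(s, n) := \matrix_(i, j) S i j w.

(* sigma(x_1, ..., x_n, S_2, ..., S_mn) *)
Definition sigma_design (n mn : nat) (x : 'I_n -> {RV P >-> X})
    (s : nat -> nat) (S : forall m, 'I_(s m) -> 'I_n -> {RV P >-> R}) :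
    set (set Omega) :=
  <<s (\bigcup_i preimage_set_system setT (x i) measurable) `|`
      (\bigcup_(m in [set m | (2 <= m <= mn)%N]) \bigcup_i \bigcup_j
         preimage_set_system setT (S m i j) measurable) >>.

Definition noise_vec (n : nat) (eps : 'I_n -> {RV P >-> R}) (w : Omega) :
    n.-tuple R := [tuple eps i w | i < n].

Definition response (n : nat) (f : X -> R) (x : 'I_n -> X) (e : n.-tuple R) :
    'cV[R]_n := \col_i (f (x i) + tnth e i).

(* lam, mn, s, x and S are indexed by the sample size n; the constants may
   depend on the order m but not on n.  log (log n) > 0 needs n >= 3. *)
Definition sketch_satisfiability (m : nat) (mn : nat -> nat) (lam : nat -> R)
    (K : X -> X -> R) (mu : nat -> R)
    (x : forall n, 'I_n -> {RV P >-> X}) (s : nat -> nat)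
    (S : forall n, 'I_(s n) -> 'I_n -> {RV P >-> R}) : Prop :=
  exists (c : R) (c1 c2 : \bar R), [/\ 0 < c, (0 < c1)%E, (0 < c2)%E &
    forall n, (3 <= n)%N -> (2 <= m <= mn n)%N ->
      of_type P (g_sigma_preimage (x n))
        [set w | satisfiable c (lam n) (kernel_mx K (sample (x n) w))
                   (random_mx (@S n) w)]
        (c1 * (s n)%:R%:E)%E
        (c2 * (s_cutoff mu (lam n))%:R%:E)%E].

End Model.

(* Main.v *)
Require Import Defs.
From HB Require Import structures.
From mathcomp Require Import all_boot all_order all_algebra.
From mathcomp Require Import all_classical all_reals all_analysis.
From mathcomp Require Import measurable_realfun ring lra.

Set Implicit Arguments.
Unset Strict Implicit.
Unset Printing Implicit Defensive.

Import Order.TTheory GRing.Theory Num.Theory.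
Import numFieldNormedType.Exports.

Local Open Scope classical_set_scope.
Local Open Scope ring_scope.

(** The adaptive statistic is at least B_n (tau_m - B_n) for every candidate
    order m, in particular for the true regularity mstar. It therefore suffices
    that tau_mstar exceeds the threshold B_n + c_alpha / B_n. Since m_n is a
    power of log n, the equation defining B_n gives B_n^2 <= 2 log m_n, so that
    this threshold is at most A sqrt (log log n) for some constant A
    (threshold_le): adaptation costs no more than that factor.

    Fix the design and the sketches and write D for the smoother Delta_mstar, q
    for the lower bound on the projection dimension s_mstar, lam for
    lambda_mstar and r = n delta(n, mstar)^2. The tuning gives n lam = c r and
    r^2 = q log log n (rates_balance). The argument has four ingredients.

    - Conditional law. Independence makes the conditional probability of each
      event of the noise almost surely constant; countably many rational boxes
      determine a law, so that outside of one null set the conditional law of the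
      noise is that of n independent standard normal variables
      (cond_distribution_iid).

    - Variance. The smoother D is symmetric with D^2 <= D <= 1, and tr D^4 is
      bounded by the effective dimension of the kernel matrix, whatever the
      sketch: tr D^4 <= k + tr K_2 / (4 lam), where K_2 is what remains of the
      kernel matrix after removing its k leading eigenfunctions
      (mxtrace_Delta4_le_tail). With k of the order of q, bounded eigenfunctions
      and polynomially decaying eigenvalues, this is O(q) for every design
      (mxtrace_Delta4_rate).

    - Bias. On the unit ball the vector of values is f = K b with b^T K b <= n
      (unit_ball_range), and D f minimises a penalised least squares criterion
      over the range of the sketch. When the sketch is K-satisfiable, one can
      match the coordinates of b along the leading eigenvectors, which gives
      |f - D f|^2 <= C n lam = O(r) (sketched_bias).

    - Concentration. Under the conditional law, n T - tr D^2 is F = |D f|^2 plus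
      a centred quadratic polynomial of the noise, whose second moment is
      2 tr D^4 + 4 |D^2 f|^2 <= 2 tr D^4 + 4 F (quad_second_moment). Chebyshev's
      inequality then bounds the probability of missing a signal
      (stat_tau_power).

    If |f|^2 >= C_2 r with C_2 large, the bias bound leaves F >= M r with M as
    large as desired. The threshold times the standard deviation is at most
    A sqrt (log log n) O(sqrt q) = O(r), hence below F / 2, and the failure
    probability is of order q / r^2 + 1 / r = 1 / log log n + 1 / r, which tends
    to 0 uniformly in f (design_power, failure_rate_small).

    There remains to see that the sketch S_mstar is satisfiable with probability
    tending to 1: this event is of (c_1 s, c_2 s_lam)-type, and both the
    projection dimension s and the number s_lam of eigenvalues above lam tend to
    infinity (s_lower_ge, s_cutoff_ge, of_type_cvg). *)

(** * Orthogonal projections and sketched smoothers *)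
Section PositiveSemidefinite.
Variable R : realFieldType.

Definition psd n (A : 'M[R]_n) : Prop :=
  forall v : 'cV[R]_n, 0 <= (v^T *m A *m v) 0 0.

Lemma mx11_mxtrace (A : 'M[R]_1) : A 0 0 = \tr A.
Proof. by rewrite /mxtrace big_ord1. Qed.

Lemma dotmx_sum n (v : 'cV[R]_n) : (v^T *m v) 0 0 = \sum_i v i 0 ^+ 2.
Proof. by rewrite mxE; apply: eq_bigr => i _; rewrite mxE expr2. Qed.

Lemma dotmx_ge0 n (v : 'cV[R]_n) : 0 <= (v^T *m v) 0 0.
Proof. by rewrite dotmx_sum sumr_ge0 // => i _; rewrite sqr_ge0. Qed.

Lemma dotmx_eq0 n (v : 'cV[R]_n) : (v^T *m v) 0 0 = 0 -> v = 0.
Proof.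
rewrite dotmx_sum => /eqP; rewrite psumr_eq0 => [/allP v0|i _]; last exact: sqr_ge0.
apply/matrixP => i j; rewrite ord1 mxE.
by have := v0 i; rewrite mem_index_enum => /(_ isT); rewrite sqrf_eq0 => /eqP.
Qed.

Lemma psd_congr n p (A : 'M[R]_n) (B : 'M[R]_(n, p)) :
  psd A -> psd (B^T *m A *m B).
Proof. by move=> A0 v; have := A0 (B *m v); rewrite trmx_mul !mulmxA. Qed.

Lemma psdD n (A B : 'M[R]_n) : psd A -> psd B -> psd (A + B).
Proof. by move=> A0 B0 v; rewrite mulmxDr mulmxDl mxE addr_ge0. Qed.

Lemma psdZ n a (A : 'M[R]_n) : 0 <= a -> psd A -> psd (a *: A).
Proof. by move=> a0 A0 v; rewrite -scalemxAr -scalemxAl mxE mulr_ge0. Qed.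

Lemma psd_gram n p (B : 'M[R]_(p, n)) : psd (B^T *m B).
Proof. by move=> v; have := dotmx_ge0 (B *m v); rewrite trmx_mul !mulmxA. Qed.

Lemma quadform_delta n (A : 'M[R]_n) i :
  ((delta_mx i 0 : 'cV[R]_n)^T *m A *m (delta_mx i 0 : 'cV[R]_n)) 0 0 = A i i.
Proof.
rewrite trmx_delta -rowE mxE (bigD1 i) //= big1 ?addr0 => [|j ji].
  by rewrite !mxE !eqxx mulr1.
by rewrite !mxE (negbTE ji) mulr0.
Qed.

Lemma mxtrace_psd_ge0 n (A : 'M[R]_n) : psd A -> 0 <= \tr A.
Proof.
by move=> A0; apply: sumr_ge0 => i _; rewrite -quadform_delta; exact: A0.
Qed.

(** Factoring through a matrix is a statement about kernels: the columns of
    the cokernel matrix of G span the kernel of G. *)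
Lemma factor_through m n p (M : 'M[R]_(m, n)) (G : 'M[R]_(p, n)) :
  (forall v : 'cV[R]_n, G *m v = 0 -> M *m v = 0) -> exists H, M = H *m G.
Proof.
move=> kerGM; apply/submxP; rewrite submxE; apply/eqP/row_matrixP => i.
apply/rowP => j.
have: col j (M *m cokermx G) = 0.
  by rewrite colE -mulmxA kerGM // mulmxA mulmx_coker mul0mx.
by move/matrixP/(_ i 0); rewrite !mxE.
Qed.

(** An idempotent matrix factors as C *m B with B *m C = 1, so that its trace
    is its rank. *)
Lemma mxtrace_idempotent n (Q : 'M[R]_n) :
  Q *m Q = Q -> \tr Q = (\rank Q)%:R.
Proof.
move=> QQ; have QE := mulmx_base Q.
have BC : row_base Q *m col_base Q = 1%:M.
  have := QQ; rewrite -{1 2 3}QE => QQ'.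
  apply: (row_free_inj (row_base_free Q)); rewrite mul1mx.
  apply: (@row_full_inj _ _ _ _ (col_base Q)); first exact: col_base_full.
  by rewrite -[RHS]QQ' !mulmxA.
by rewrite -[in LHS]QE mxtrace_mulC BC mxtrace1.
Qed.

(** The orthogonal projection onto the column space of Phi is Phi *m H^T, where
    H solves the normal equations Phi = H *m (Phi^T *m Phi). *)
Lemma orthogonal_projection n k (Phi : 'M[R]_(n, k)) :
  exists Q : 'M[R]_n, [/\ Q^T = Q, Q *m Q = Q, Q *m Phi = Phi & \tr Q <= k%:R].
Proof.
have [|H PhiE] := @factor_through _ _ _ Phi (Phi^T *m Phi).
  move=> v gram0; apply: dotmx_eq0.
  by rewrite trmx_mul -mulmxA [Phi^T *m _]mulmxA gram0 mulmx0 mxE.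
have PhiTE : Phi^T = Phi^T *m Phi *m H^T.
  by rewrite {1}PhiE !trmx_mul trmxK.
have QE : Phi *m H^T = H *m Phi^T.
  by rewrite {1}PhiE -mulmxA [in RHS]PhiTE !mulmxA.
have QPhi : Phi *m H^T *m Phi = Phi by rewrite QE -mulmxA -PhiE.
have QQ : Phi *m H^T *m (Phi *m H^T) = Phi *m H^T by rewrite mulmxA QPhi.
exists (Phi *m H^T); split=> //; first by rewrite trmx_mul trmxK QE.
rewrite mxtrace_idempotent // ler_nat.
by apply: leq_trans (mxrankM_maxl _ _) _; exact: rank_leq_col.
Qed.

End PositiveSemidefinite.

Section SketchedSmoother.
Variables (R : realType) (s n : nat) (K : 'M[R]_n) (S : 'M[R]_(s, n)) (lam : R).
Hypotheses (Ksym : K^T = K) (Kpsd : psd K) (lam_gt0 : 0 < lam).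

Let G : 'M[R]_s := S *m K *m K *m S^T + lam *: (S *m K *m S^T).

Let Gsym : G^T = G.
Proof. by rewrite /G linearD linearZ /= !trmx_mul trmxK Ksym !mulmxA. Qed.

(** The matrix inverted in the smoother vanishes only where K *m S^T does, so
    that K *m S^T factors through it; this is what makes the generalised
    inverse harmless.  With K *m S^T = H *m G, the fitted values are obtained
    from the coefficients H^T *m y. *)
Lemma Delta_factor : exists H : 'M[R]_(n, s),
  [/\ S *m K = G *m H^T,
      Delta lam K S = K *m (S^T *m H^T), (Delta lam K S)^T = Delta lam K S &
      Delta lam K S *m Delta lam K S = Delta lam K S -
        lam *: ((S^T *m H^T)^T *m K *m (S^T *m H^T))].
Proof.
have [|H HE] := @factor_through _ _ _ _ (K *m S^T) G.
  move=> v Gv0; apply: dotmx_eq0.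
  have := dotmx_ge0 (K *m S^T *m v).
  have := Kpsd (S^T *m v).
  have : (v^T *m G *m v) 0 0 = 0 by rewrite -mulmxA Gv0 mulmx0 mxE.
  rewrite /G !(trmx_mul, trmxK) Ksym !(mulmxDr, mulmxDl) -!(scalemxAr, scalemxAl).
  rewrite !mulmxA [in LHS]mxE [in X in _ + X]mxE.
  set a := (X in X + _) => ab b0 a0.
  have lb0 := mulr_ge0 (ltW lam_gt0) b0.
  by apply/eqP; rewrite eq_le a0 andbT -ab lerDl.
have SKE : S *m K = G *m H^T.
  by rewrite -[S *m K]trmxK trmx_mul Ksym HE trmx_mul Gsym.
have DE : Delta lam K S = H *m G *m H^T.
  by rewrite /Delta -/G -[_ *m S *m K]mulmxA SKE HE mulmxA mulmxKpV ?submxMl.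
have KW : K *m (S^T *m H^T) = H *m G *m H^T by rewrite mulmxA HE.
exists H; rewrite KW; split=> //.
  by rewrite DE !trmx_mul trmxK Gsym mulmxA.
rewrite DE; transitivity (H *m (S *m K *m K *m S^T) *m H^T).
  have -> : S *m K *m K *m S^T = G *m H^T *m (H *m G).
    by rewrite -SKE -HE !mulmxA.
  by rewrite !mulmxA.
rewrite /G mulmxDr mulmxDl -scalemxAr -scalemxAl trmx_mul !trmxK.
by rewrite !mulmxA addrK.
Qed.

Local Notation D := (Delta lam K S).

Lemma Delta_sym : D^T = D.
Proof. by have [H []] := Delta_factor. Qed.

(** Delta is a contraction: its square differs from it by minus the roughness
    penalty of the fitted coefficients. *)
Lemma psd_Delta_sub_sqr : psd (D - D *m D).
Proof.
have [H [_ _ _ ->]] := Delta_factor; rewrite subKr.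
by apply: psdZ (ltW lam_gt0) _; exact: psd_congr.
Qed.

Lemma psd_1_sub_Delta : psd (1%:M - D).
Proof.
have symX : (1%:M - D)^T = 1%:M - D by rewrite [LHS]linearB /= Delta_sym trmx1.
have -> : 1%:M - D = (1%:M - D)^T *m (1%:M - D) + (D - D *m D).
  by rewrite symX mulmxBl !mulmxBr mulmx1 !mul1mx mulmx1 subrK.
by apply: psdD; [exact: psd_gram | exact: psd_Delta_sub_sqr].
Qed.

Lemma mxtrace_Delta4_le : \tr (D ^+ 4) <= \tr (D ^+ 2).
Proof.
rewrite -subr_ge0 -linearB /=.
have -> : D ^+ 2 - D ^+ 4 = D^T *m ((1%:M - D) + (D - D *m D)) *m D.
  rewrite Delta_sym addrA subrK mulmxBr mulmx1 mulmxBl.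
  by rewrite [D ^+ 4](exprD _ 2 2) expr2 -!mulmxE !mulmxA.
apply: mxtrace_psd_ge0; apply: psd_congr; apply: psdD.
  exact: psd_1_sub_Delta.
exact: psd_Delta_sub_sqr.
Qed.

(** The effective dimension of the sketched smoother is controlled by any
    orthogonal projection Q, whatever the sketch is. On the range of Q, use that
    Delta is a contraction. On the orthogonal complement X = 1 - Q, Delta = K *m W
    and the Cauchy-Schwarz inequality for the form K bounds tr (X K W) by
    tr (X K X) / (4 lam) plus the penalty lam tr (W^T K W), which is exactly
    tr Delta - tr Delta^2. *)
Lemma mxtrace_Delta2_le (Q : 'M[R]_n) : Q^T = Q -> Q *m Q = Q ->
  \tr (D ^+ 2) <=
    \tr Q + \tr ((1%:M - Q) *m K *m (1%:M - Q)) / (4 * lam).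
Proof.
move=> Qsym QQ; have [H [_ DE _ DD]] := Delta_factor.
move: (S^T *m H^T) DE DD => W DE DD; pose X : 'M[R]_n := 1%:M - Q; rewrite -/X.
have Xsym : X^T = X by rewrite /X linearB /= trmx1 Qsym.
have trXD : \tr (X *m D) = \tr D - \tr (Q *m D).
  by rewrite /X mulmxBl mul1mx linearB.
clearbody X.
have trD2 : \tr (D ^+ 2) = \tr D - lam * \tr (W^T *m K *m W).
  by rewrite expr2 -mulmxE DD linearB linearZ.
have trQD : \tr (Q *m D) <= \tr Q.
  rewrite -subr_ge0 -linearB /= -{1}[Q]mulmx1 -mulmxBr -{1}QQ -mulmxA mxtrace_mulC.
  rewrite -{1}Qsym; apply: mxtrace_psd_ge0; apply: psd_congr.
  exact: psd_1_sub_Delta.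
have trWKX : \tr (W^T *m K *m X) = \tr (X *m K *m W).
  by rewrite -mxtrace_tr !trmx_mul trmxK Ksym Xsym mulmxA.
have := mxtrace_psd_ge0 (psd_congr (X - (2 * lam) *: W) Kpsd).
have symXW : (X - (2 * lam) *: W)^T = X - (2 * lam) *: W^T.
  by rewrite [LHS]linearB /= linearZ /= Xsym.
rewrite symXW !(mulmxBl, mulmxBr) -!(scalemxAl, scalemxAr).
rewrite !linearB !linearZ /= trWKX -[X *m K *m W]mulmxA -DE trXD.
move=> amgm; rewrite trD2 -lerBlDl.
rewrite ler_pdivlMr; last by rewrite mulr_gt0.
have lamQD := ler_wpM2r (ltW lam_gt0) trQD.
move: amgm lamQD; rewrite /GRing.scale /=; nra.
Qed.

(** If K is the sum of a matrix whose range lies in that of Phi, which has k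
    columns, and of a positive semidefinite remainder, then projecting on the
    range of Phi leaves only the trace of the remainder. *)
Lemma mxtrace_Delta4_le_tail k (Phi : 'M[R]_(n, k)) (B : 'M[R]_(k, n))
    (K2 : 'M[R]_n) :
  K = Phi *m B + K2 -> psd K2 ->
  \tr (D ^+ 4) <= k%:R + \tr K2 / (4 * lam).
Proof.
move=> KE K2psd; have [Q [Qsym QQ QPhi trQ]] := orthogonal_projection Phi.
apply: le_trans mxtrace_Delta4_le _; apply: le_trans (mxtrace_Delta2_le Qsym QQ) _.
apply: lerD => //; apply: ler_wpM2r; first by rewrite invr_ge0 mulr_ge0 ?ltW.
have -> : (1%:M - Q) *m K = (1%:M - Q) *m K2.
  by rewrite KE mulmxDr mulmxA [_ *m Phi]mulmxBl mul1mx QPhi subrr mul0mx add0r.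
have XX : (1%:M - Q) *m (1%:M - Q) = 1%:M - Q.
  by rewrite mulmxBr mulmx1 mulmxBl mul1mx QQ subrr subr0.
rewrite mxtrace_mulC mulmxA XX.
rewrite mulmxBl mul1mx linearB /= gerBl -QQ -mulmxA mxtrace_mulC.
by rewrite -{1}Qsym; apply: mxtrace_psd_ge0; exact: psd_congr.
Qed.

End SketchedSmoother.

(** * Bias of a sketched smoother *)
Section Bias.
Variable R : realType.

Lemma mulmx_pid_tr n k m (hk : (k <= n)%N) (v : 'M[R]_(n, m)) (j : 'I_k) i :
  ((pid_mx k : 'M[R]_(n, k))^T *m v) j i = v (widen_ord hk j) i.
Proof.
rewrite mxE (bigD1 (widen_ord hk j)) //= big1 ?addr0 => [|l lj].
  by rewrite !mxE eqxx /= ltn_ord mul1r.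
rewrite !mxE; have [E|] := eqVneq (l : nat) j; last by rewrite /= mul0r.
by case/eqP: lj; apply: val_inj.
Qed.

Lemma mulmx_tail_tr n k m (v : 'M[R]_(n, m)) (j : 'I_(n - k))
    (hj : (k + j < n)%N) i :
  ((tail_mx n k : 'M[R]_(n, n - k))^T *m v) j i = v (Ordinal hj) i.
Proof.
rewrite mxE (bigD1 (Ordinal hj)) //= big1 ?addr0 => [|l lj].
  by rewrite !mxE eqxx mul1r.
rewrite !mxE; have [E|] := eqVneq (l : nat) (k + j)%N; last by rewrite mul0r.
by case/eqP: lj; apply: val_inj.
Qed.

Lemma enorm_sqr n (v : 'cV[R]_n) : enorm v ^+ 2 = (v^T *m v) 0 0.
Proof. by rewrite sqr_sqrtr ?dotmx_sum // -dotmx_sum dotmx_ge0. Qed.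

Lemma enormZ n a (v : 'cV[R]_n) : enorm (a *: v) = `|a| * enorm v.
Proof.
apply/eqP; rewrite -(@eqrXn2 _ 2) ?sqrtr_ge0 ?mulr_ge0 ?sqrtr_ge0 //.
rewrite exprMn !enorm_sqr !dotmx_sum real_normK ?num_real // mulr_sumr.
by apply/eqP; apply: eq_bigr => i _; rewrite mxE exprMn.
Qed.

Lemma enorm_mulmx_le p q (A : 'M[R]_(p, q)) (v : 'cV[R]_q) :
  enorm (A *m v) <= opnorm A * enorm v.
Proof.
have unit_le (w : 'cV[R]_q) : enorm w <= 1 -> enorm (A *m w) <= opnorm A.
  move=> w1; apply: ub_le_sup; last by exists w.
  exists (Num.sqrt (\sum_i (\sum_j `|A i j|) ^+ 2)) => _ [u /= u1 <-].
  rewrite ler_sqrt; last by apply: sumr_ge0 => i _; exact: sqr_ge0.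
  apply: ler_sum => i _; rewrite mxE -(@real_normK _ (\sum_j _)) ?num_real //.
  rewrite lerXn2r ?nnegrE ?sumr_ge0 //.
  apply: le_trans (ler_norm_sum _ _ _) _; apply: ler_sum => j _.
  rewrite normrM ler_piMr // -(ler_pXn2r (ltn0Sn 1)) ?nnegrE // real_normK ?num_real //.
  apply: (@le_trans _ _ (enorm u ^+ 2)).
    rewrite enorm_sqr dotmx_sum (bigD1 j) //= lerDl.
    by apply: sumr_ge0 => l _; exact: sqr_ge0.
  by rewrite lerXn2r ?nnegrE ?sqrtr_ge0.
have enorm0 m : enorm (0 : 'cV[R]_m) = 0.
  by rewrite -(scale0r (0 : 'cV[R]_m)) enormZ normr0 mul0r.
have [v0|v0] := eqVneq (enorm v) 0.
  have -> : v = 0 by apply: dotmx_eq0; rewrite -enorm_sqr v0 expr0n.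
  by rewrite mulmx0 !enorm0 mulr0.
have v_gt0 : 0 < enorm v by rewrite lt_neqAle eq_sym v0 sqrtr_ge0.
have := unit_le ((enorm v)^-1 *: v).
rewrite -scalemxAr !enormZ gtr0_norm ?invr_gt0 // mulVf // => /(_ (lexx _)).
by rewrite mulrC ler_pdivrMr.
Qed.

Lemma quadform_sym n (K : 'M[R]_n) (u v : 'cV[R]_n) : K^T = K ->
  (u^T *m K *m v) 0 0 = (v^T *m K *m u) 0 0.
Proof.
by move=> Ksym; rewrite !mx11_mxtrace -mxtrace_tr !trmx_mul trmxK Ksym mulmxA.
Qed.

Lemma quadformD n (K : 'M[R]_n) (u v : 'cV[R]_n) : K^T = K ->
  ((u + v)^T *m K *m (u + v)) 0 0 =
    (u^T *m K *m u) 0 0 + 2 * (u^T *m K *m v) 0 0 + (v^T *m K *m v) 0 0.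
Proof.
move=> Ksym; have symK := quadform_sym u v Ksym.
rewrite [(u + v)^T]linearD /= !mulmxDl !mulmxDr.
rewrite [LHS]mxE [X in X + _]mxE [X in _ + X]mxE -symK; ring.
Qed.

Lemma dotmxD n (u v : 'cV[R]_n) :
  ((u + v)^T *m (u + v)) 0 0 =
    (u^T *m u) 0 0 + 2 * (u^T *m v) 0 0 + (v^T *m v) 0 0.
Proof. by have := quadformD u v (trmx1 R n); rewrite !mulmx1. Qed.

Lemma dotmxDr n (u v w : 'cV[R]_n) :
  (w^T *m (u + v)) 0 0 = (w^T *m u) 0 0 + (w^T *m v) 0 0.
Proof. by rewrite mulmxDr mxE. Qed.

Lemma dotmxZr n a (u v : 'cV[R]_n) :
  (u^T *m (a *: v)) 0 0 = a * (u^T *m v) 0 0.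
Proof. by rewrite -scalemxAr mxE. Qed.

Lemma dotmxZl n a (u v : 'cV[R]_n) :
  ((a *: u)^T *m v) 0 0 = a * (u^T *m v) 0 0.
Proof. by rewrite [(a *: u)^T]linearZ /= -scalemxAl mxE. Qed.

(** The fitted values minimise the penalised least squares criterion over the
    coefficient vectors in the range of S^T: the normal equations say that the
    criterion at ua = uf + h exceeds its value at uf by the nonnegative
    quadratic part in h. *)
Lemma sketched_fit_optimal s n (K : 'M[R]_n) (S : 'M[R]_(s, n)) (lam : R)
    (f : 'cV[R]_n) (a : 'cV[R]_s) :
  K^T = K -> psd K -> 0 < lam ->
  let fit := Delta lam K S *m f in
  ((f - fit)^T *m (f - fit)) 0 0 <=
    ((f - K *m (S^T *m a))^T *m (f - K *m (S^T *m a))) 0 0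
    + lam * ((S^T *m a)^T *m K *m (S^T *m a)) 0 0.
Proof.
move=> Ksym Kpsd lam0; have [H [SKE DE _ _]] := Delta_factor S Ksym Kpsd lam0.
set ua := S^T *m a; set uf := S^T *m H^T *m f; set h := ua - uf => /=.
have fitE : Delta lam K S *m f = K *m uf by rewrite DE -mulmxA.
have hE : h = S^T *m (a - H^T *m f) by rewrite /h /ua /uf mulmxBr mulmxA.
have normal_eq : (h^T *m K *m (f - K *m uf)) = lam *: (h^T *m K *m uf).
  rewrite hE trmx_mul trmxK -!mulmxA scalemxAr; congr (_ *m _).
  apply/eqP; rewrite mulmxBr mulmxBr subr_eq.
  rewrite [S *m (K *m f)]mulmxA SKE /uf mulmxDl mulmxDl -!scalemxAl addrC.
  by rewrite !mulmxA.
rewrite fitE; set r := f - K *m uf in normal_eq *.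
have -> : f - K *m ua = r + - (K *m h).
  by rewrite /h mulmxBr opprB addrA subrK.
have -> : ua = uf + h by rewrite /h addrC subrK.
move/matrixP/(_ 0 0): normal_eq; rewrite [RHS]mxE => normal_eq.
have Kh0 := dotmx_ge0 (K *m h); have h0 := Kpsd h; have uf0 := Kpsd uf.
have cross : (r^T *m - (K *m h)) 0 0 = - (h^T *m K *m r) 0 0.
  by rewrite mulmxN mxE mulmxA quadform_sym.
have sqN : ((- (K *m h))^T *m - (K *m h)) 0 0 = ((K *m h)^T *m (K *m h)) 0 0.
  by rewrite !dotmx_sum; apply: eq_bigr => i _; rewrite mxE sqrrN.
clearbody r; rewrite dotmxD quadformD // cross sqN normal_eq quadform_sym //.
have := mulr_ge0 (ltW lam0) h0; have := mulr_ge0 (ltW lam0) uf0.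
lra.
Qed.

(** A sketch that nearly preserves the geometry of a subspace is onto the dual
    of that subspace, with coefficient vectors of controlled length. *)
Lemma near_isometry_solve s k (A : 'M[R]_(s, k)) (b : 'cV[R]_k) :
  opnorm (A^T *m A - 1%:M) <= 2^-1 ->
  exists2 a : 'cV[R]_s, A^T *m a = b & (a^T *m a) 0 0 <= 2 * (b^T *m b) 0 0.
Proof.
move=> opA.
have lower (w : 'cV[R]_k) :
    (w^T *m w) 0 0 <= 2 * (w^T *m (A^T *m A *m w)) 0 0.
  set E := A^T *m A - 1%:M in opA.
  have -> : A^T *m A *m w = w + E *m w by rewrite /E mulmxBl mul1mx addrC subrK.
  have := dotmx_ge0 (w + 2 *: (E *m w)).
  have : (((E *m w))^T *m (E *m w)) 0 0 <= 2^-1 ^+ 2 * (w^T *m w) 0 0.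
    rewrite -!enorm_sqr -exprMn lerXn2r ?nnegrE ?mulr_ge0 ?sqrtr_ge0 //.
    by apply: le_trans (enorm_mulmx_le _ _) _; apply: ler_wpM2r => //; exact: sqrtr_ge0.
  clearbody E; rewrite dotmxD dotmxDr !(dotmxZl, dotmxZr).
  lra.
have [|H HE] := @factor_through _ _ _ _ 1%:M (A^T *m A).
  move=> v Av; rewrite mul1mx; apply: dotmx_eq0; apply/eqP.
  by rewrite eq_le dotmx_ge0 andbT (le_trans (lower v)) // Av mulmx0 mxE mulr0.
have AH : A^T *m A *m H = 1%:M by apply: mulmx1C.
set u := H *m b; have Au : A^T *m A *m u = b by rewrite mulmxA AH mul1mx.
exists (A *m u); first by rewrite mulmxA.
clearbody u; have := lower u; rewrite Au trmx_mul -mulmxA [A^T *m _]mulmxA Au.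
have := dotmx_ge0 (u + (- 2) *: b).
rewrite dotmxD !(dotmxZl, dotmxZr).
lra.
Qed.

Lemma opnorm_trmx_le p q (A : 'M[R]_(p, q)) (c : R) (a : 'cV[R]_p) :
  0 < c -> opnorm A <= c ->
  ((A^T *m a)^T *m (A^T *m a)) 0 0 <= c ^+ 2 * (a^T *m a) 0 0.
Proof.
move=> c0 Ac; set x := A^T *m a.
have : ((A *m x)^T *m (A *m x)) 0 0 <= c ^+ 2 * (x^T *m x) 0 0.
  rewrite -!enorm_sqr -exprMn lerXn2r ?nnegrE ?mulr_ge0 ?sqrtr_ge0 ?(ltW c0) //.
  by apply: le_trans (enorm_mulmx_le _ _) _; apply: ler_wpM2r => //; exact: sqrtr_ge0.
have -> : (x^T *m x) 0 0 = (a^T *m (A *m x)) 0 0 by rewrite trmx_mul trmxK mulmxA.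
have := dotmx_ge0 (c ^+ 2 *: a + (- 1) *: (A *m x)).
clearbody x; rewrite dotmxD !(dotmxZl, dotmxZr).
have c20 : 0 < c ^+ 2 by rewrite exprn_gt0.
move=> sq Ax; rewrite -(ler_pM2l c20); lra.
Qed.

Lemma find_enum_ord n (p : pred 'I_n) (i : 'I_n) :
  (i < find p (enum 'I_n))%N -> ~~ p i.
Proof.
by move=> ip; have := before_find i ip; rewrite nth_ord_enum => ->.
Qed.

Lemma find_enum_ord_le n (p : pred 'I_n) : (find p (enum 'I_n) <= n)%N.
Proof. by rewrite (leq_trans (find_size _ _)) // size_enum_ord. Qed.

Lemma sum_tail n k (F : 'I_n -> R) (G : 'I_(n - k) -> R) : (k <= n)%N ->
  (forall (i : 'I_n) (j : 'I_(n - k)), (i : nat) = (k + j)%N -> F i = G j) ->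
  \sum_(i < n | (k <= i)%N) F i = \sum_j G j.
Proof.
move=> kn FG; have hj (j : 'I_(n - k)) : (k + j < n)%N by rewrite -ltn_subRL.
rewrite (@reindex_omap _ _ _ _ _ (fun j => Ordinal (hj j))
  (fun i : 'I_n => insub (i - k)%N)) /= => [|i ki].
  apply: eq_big => [j|j _]; last exact: FG.
  rewrite leq_addr /= addKn insubT //= => ?.
  by apply/eqP; congr Some; apply: val_inj.
case: insubP => [j _ /= jE|].
  by congr Some; apply: val_inj; rewrite /= jE subnKC.
by rewrite ltn_sub2r // (leq_ltn_trans ki).
Qed.

(** Approximation error of the sketched smoother on the vectors K *m b. On a
    satisfiable sketch one can choose a coefficient vector a whose coordinates
    agree with those of b along the eigenvectors with large eigenvalues; the
    remaining coordinates are damped by the small eigenvalues, both in the fit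
    and in the penalty. *)
Lemma sketched_bias s n (K : 'M[R]_n) (S : 'M[R]_(s, n)) (lam c : R)
    (b : 'cV[R]_n) :
  K^T = K -> psd K -> 0 < lam -> 0 < c -> satisfiable c lam K S ->
  let r := K *m b - Delta lam K S *m (K *m b) in
  (r^T *m r) 0 0 <= lam * (2 + 6 * c ^+ 2) * (b^T *m K *m b) 0 0.
Proof.
move=> Ksym Kpsd lam0 c0 [U [mu [[UU muD mu0 KE] /=]]].
set k := s_cutoff_emp mu lam => -[opU1 opU2] /=.
have kn : (k <= n)%N := find_enum_ord_le _.
have UTU : U^T *m U = 1%:M := mulmx1C UU.
have mu_head (i : 'I_n) : (i < k)%N -> lam <= mu 0 i.
  by move=> /find_enum_ord; rewrite -ltNge => /ltW.
have mu_tail (i : 'I_n) : (k <= i)%N -> mu 0 i <= lam.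
  move=> ki; have kn' : (k < n)%N := leq_ltn_trans ki (ltn_ord i).
  apply: le_trans (muD (Ordinal kn') i ki) _.
  have hasp : has (fun i => mu 0 i <= lam) (enum 'I_n).
    by rewrite has_find size_enum_ord.
  have := nth_find (Ordinal kn') hasp.
  by rewrite -[find _ _]/(nat_of_ord (Ordinal kn')) nth_ord_enum.
pose g (v : 'cV[R]_n) i := (U^T *m v) i 0.
have formE (v : 'cV[R]_n) : (v^T *m K *m v) 0 0 = \sum_i mu 0 i * g v i ^+ 2.
  rewrite KE -!mulmxA [_ *m (U *m _)]mulmxA -[v^T *m U]trmxK trmx_mul trmxK.
  rewrite mxE; apply: eq_bigr => i _.
  by rewrite mul_diag_mx !mxE /g !mxE mulrCA expr2.
have sqrE (v : 'cV[R]_n) : ((K *m v)^T *m (K *m v)) 0 0 =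
    \sum_i mu 0 i ^+ 2 * g v i ^+ 2.
  transitivity (((U^T *m (K *m v))^T *m (U^T *m (K *m v))) 0 0).
    rewrite [(U^T *m _)^T]trmx_mul trmxK -mulmxA [U *m (_ *m _)]mulmxA UU.
    by rewrite mul1mx.
  rewrite dotmx_sum.
  apply: eq_bigr => i _; rewrite KE !mulmxA UTU mul1mx -mulmxA mul_diag_mx.
  by rewrite mxE /g exprMn.
have [a solve la] := near_isometry_solve
  ((pid_mx k : 'M[R]_(n, k))^T *m (U^T *m b)) opU1.
have ag_head (i : 'I_n) : (i < k)%N -> g (S^T *m a) i = g b i.
  move=> ik; have E : i = widen_ord kn (Ordinal ik) by apply: val_inj.
  rewrite /g E -!mulmx_pid_tr -solve !trmx_mul.
  by rewrite !mulmxA.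
have la' : lam * (a^T *m a) 0 0 <= 2 * (b^T *m K *m b) 0 0.
  apply: le_trans (ler_wpM2l (ltW lam0) la) _; rewrite mulrCA ler_pM2l //.
  rewrite dotmx_sum formE mulr_sumr (bigID (fun i : 'I_n => (i < k)%N)) /=.
  apply: ler_wpDr; first by apply: sumr_ge0 => i _; rewrite mulr_ge0 ?sqr_ge0.
  rewrite (big_ord_narrow kn) /=; apply: ler_sum => i _.
  by rewrite (mulmx_pid_tr kn) ler_wpM2r ?sqr_ge0 // mu_head /=.
have tail_le : \sum_(i < n | (k <= i)%N) mu 0 i * g (S^T *m a) i ^+ 2 <=
    c ^+ 2 * (2 * (b^T *m K *m b) 0 0).
  apply: (@le_trans _ _ ((c * Num.sqrt lam) ^+ 2 * (a^T *m a) 0 0)); last first.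
    rewrite exprMn sqr_sqrtr ?(ltW lam0) // -mulrA.
    by apply: ler_wpM2l; rewrite ?sqr_ge0.
  apply: le_trans (opnorm_trmx_le a _ opU2); last by rewrite mulr_gt0 ?sqrtr_gt0.
  rewrite dotmx_sum le_eqVlt; apply/orP; left; apply/eqP; apply: sum_tail => // i j ij.
  have hj : (k + j < n)%N by rewrite -ij.
  have -> : i = Ordinal hj by apply: val_inj.
  rewrite !trmx_mul tr_diag_mx -!mulmxA mul_diag_mx [in RHS]mxE.
  rewrite (mulmx_tail_tr _ hj) exprMn; congr (_ * _).
  have tailE : (mu *m tail_mx n k) 0 j = mu 0 (Ordinal hj).
    have := mulmx_tail_tr mu^T hj 0.
    by rewrite -trmx_mul [in X in X -> _]mxE [in X in _ = X -> _]mxE.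
  by rewrite mxE tailE sqr_sqrtr.
apply: le_trans (sketched_fit_optimal S _ a Ksym Kpsd lam0) _.
rewrite -mulmxBr sqrE !formE mulr_sumr -big_split /=.
have gB i : g (b - S^T *m a) i = g b i - g (S^T *m a) i.
  by rewrite /g mulmxBr !mxE.
apply: (@le_trans _ _ (\sum_i (lam * 2 * (mu 0 i * g b i ^+ 2)
    + if (k <= i)%N then lam * 3 * (mu 0 i * g (S^T *m a) i ^+ 2) else 0))).
  apply: ler_sum => i _; rewrite gB; have mi0 := mu0 i.
  case: leqP => [ki|ik]; last first.
    rewrite ag_head // subrr expr0n mulr0 add0r addr0.
    have := mulr_ge0 (ltW lam0) (mulr_ge0 mi0 (sqr_ge0 (g b i))); lra.
  have mul : mu 0 i ^+ 2 <= lam * mu 0 i by rewrite expr2 ler_wpM2r ?mu_tail.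
  have sq0 : 0 <= (g b i + g (S^T *m a) i) ^+ 2 by exact: sqr_ge0.
  have := ler_wpM2r (sqr_ge0 (g b i - g (S^T *m a) i)) mul.
  have := mulr_ge0 (mulr_ge0 (ltW lam0) mi0) sq0.
  move: (g b i) (g _ i) => p q.
  lra.
rewrite big_split /= -mulr_sumr -formE -big_mkcond -mulr_sumr.
have := ler_wpM2l (mulr_ge0 (ltW lam0) (ler0n _ 3)) tail_le.
move: (\sum_(i | _) _) ((b^T *m _ *m _) 0 0) => p q; lra.
Qed.


End Bias.

(** * Moments of the standard normal law *)
(** The normal law lives on the alias measurableTypeR R; pushing it forward by
    this identity map carries it to R itself. *)
Definition idTR (R : realType) : measurableTypeR R -> R := idfun.

HB.instance Definition _ (R : realType) :=
  @isMeasurableFun.Build _ _ _ _ (@idTR R) (@measurable_id _ _ setT).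

Section GaussianDensity.
Variable R : realType.
Local Notation mu := (@lebesgue_measure R).
Local Notation gauss := (normal_prob 0 1 : set R -> \bar R).
Local Notation pdf := (normal_pdf (0 : R) 1).

Lemma std_pdfE (x : R) : pdf x = normal_peak 1 * expR (- (x ^+ 2 / 2)).
Proof.
rewrite normal_pdfE ?oner_neq0 // /normal_fun subr0 expr1n.
by rewrite mulNr.
Qed.

Lemma std_pdfN (x : R) : pdf (- x) = pdf x.
Proof. by rewrite !std_pdfE sqrrN. Qed.

Lemma continuous_std_pdf : continuous pdf.
Proof. by apply: continuous_normal_pdf; exact: oner_neq0. Qed.

Lemma is_derive_std_pdf (x : R) : is_derive x 1 pdf (- (x * pdf x)).
Proof.
have -> : pdf = (fun y => normal_peak 1 * expR (- (y ^+ 2 / 2))).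
  by apply/funext => y; rewrite std_pdfE.
apply: is_derive_eq; rewrite /GRing.scale /=; by field.
Qed.

(** The inequality 1 + y + y^2 / 2 <= exp y at y = x^2 / 2 turns the density
    into a multiple of x^-4, which absorbs three powers of x. *)
Lemma std_pdf_decay (k : nat) : (k <= 3)%N -> x ^+ k * pdf x @[x --> +oo%R] --> (0 : R).
Proof.
move=> k3; apply: (@squeeze_cvgr _ _ _ _ (cst 0) (fun x => 8 * normal_peak 1 * x^-1) _).
- near=> x.
  have x1 : 1 <= x by near: x; exact: nbhs_pinfty_ge.
  have x0 : 0 < x by apply: lt_le_trans x1.
  rewrite /cst mulr_ge0 ?exprn_ge0 ?normal_pdf_ge0 ?(ltW x0) //=.
  have ex : x ^+ 4 / 8 <= expR (x ^+ 2 / 2).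
    have := @expR_ge1Dxn _ (x ^+ 2 / 2) 1 _; rewrite divr_ge0 ?sqr_ge0 // => /(_ isT).
    apply: le_trans; rewrite (_ : (x ^+ 2 / 2) ^+ 2 / 2`!%:R = x ^+ 4 / 8) ?lerDr //.
    by rewrite (_ : 2`! = 2%N) //; field.
  rewrite std_pdfE expRN.
  apply: (@le_trans _ _ (x ^+ 3 * (normal_peak 1 * (x ^+ 4 / 8)^-1))).
    apply: ler_pM; rewrite ?exprn_ge0 ?(ltW x0) ?mulr_ge0 ?normal_peak_ge0 ?invr_ge0 ?expR_ge0 //.
      exact: ler_weXn2l.
    apply: ler_wpM2l; first exact: normal_peak_ge0.
    by rewrite lef_pV2 ?posrE ?expR_gt0 // divr_gt0 ?exprn_gt0.
  rewrite le_eqVlt; apply/orP; left; apply/eqP; field.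
  by rewrite gt_eqF.
- exact: cvg_cst.
- rewrite -[X in _ --> X](mulr0 (8 * normal_peak 1)); apply: cvgM; first exact: cvg_cst.
  apply/gtr0_cvgV0; last exact: cvg_id.
  exact: nbhs_pinfty_gt.
Unshelve. all: by end_near. Qed.

Definition std_cdf (x : R) : R := \int[mu]_(t in `]-oo, x]) pdf t.

Lemma is_derive_std_cdf (x : R) : is_derive x 1 std_cdf (pdf x).
Proof.
have [||||dF F'] := @continuous_FTC1 _ pdf -oo%O x (x + 1).
- by rewrite ltrDl.
- by apply: integrableS (integrable_normal_pdf 0 1).
- exact: ltNyr.
- exact: continuous_std_pdf.
by rewrite -F' derive1E; apply: DeriveDef.
Qed.

Lemma cvg_std_cdf : std_cdf x @[x --> +oo%R] --> (1 : R).
Proof.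
apply: fine_cvg.
exact: (@cvg_cdfy1 _ _ _ (normal_prob 0 1 : probability _ R)
          (@idTR R : {RV (normal_prob 0 1 : probability _ R) >-> R})).
Qed.

(** The densities have explicit primitives in terms of the distribution
    function and of x^k times the density. Its value at 0 is kept unknown: it
    follows from the total mass by symmetry. *)
Lemma half_line_moments :
  [/\ (\int[mu]_(x in `[0%R, +oo[) (pdf x)%:E = (1 - std_cdf 0)%:E)%E,
      (\int[mu]_(x in `[0%R, +oo[) (x ^+ 2 * pdf x)%:E = (1 - std_cdf 0)%:E)%E &
      (\int[mu]_(x in `[0%R, +oo[) (x ^+ 4 * pdf x)%:E
         = (3 * (1 - std_cdf 0))%:E)%E].
Proof.
have cX k : continuous (fun x : R => x ^+ k * pdf x).
  by move=> x; apply: cvgM; [exact: exprn_continuous|exact: continuous_std_pdf].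
have FTC (f F : R -> R) (l : R) : (forall x, 0 <= f x) -> continuous f ->
    (forall x : R, is_derive x 1 F (f x)) -> F x @[x --> +oo%R] --> l ->
    (\int[mu]_(x in `[0%R, +oo[) (f x)%:E = l%:E - (F 0)%:E)%E.
  move=> f0 cf dF Fl; apply: ge0_continuous_FTC2y => //.
  - exact: continuous_subspaceT.
  - by apply: cvg_at_right_filter; apply: differentiable_continuous;
      apply/derivable1_diffP; case: (dF 0).
  - by move=> x _; rewrite derive1E; case: (dF x).
have pdf0 x : 0 <= pdf x := normal_pdf_ge0 0 1 x.
have dP x := is_derive_std_pdf x; have dC x := is_derive_std_cdf x.
split.
- rewrite (FTC _ std_cdf 1) //; first exact: continuous_std_pdf.
  exact: cvg_std_cdf.
- have dF (x : R) : is_derive x (1 : R) (fun x => std_cdf x - x ^+ 1 * pdf x)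
      (x ^+ 2 * pdf x).
    by apply: is_derive_eq; rewrite /GRing.scale /=; ring.
  rewrite (FTC _ _ 1 _ (cX 2) dF); first by rewrite mul0r subr0.
  + by move=> x; rewrite mulr_ge0 ?sqr_ge0.
  + rewrite -[X in _ --> X]subr0; apply: cvgB; first exact: cvg_std_cdf.
    exact: std_pdf_decay.
- have dF (x : R) : is_derive x (1 : R)
      (fun x => 3 * (std_cdf x - x ^+ 1 * pdf x) - x ^+ 3 * pdf x)
      (x ^+ 4 * pdf x).
    by apply: is_derive_eq; rewrite /GRing.scale /=; ring.
  rewrite (FTC _ _ 3 _ (cX 4) dF).
  + by rewrite !expr0n /= !mul0r !subr0 mulrBr mulr1.
  + by move=> x; rewrite mulr_ge0 // exprn_even_ge0.
  + rewrite -[X in _ --> X]subr0; apply: cvgB; last exact: std_pdf_decay.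
    rewrite -[X in _ --> X]mulr1; apply: cvgM; first exact: cvg_cst.
    by rewrite -[X in _ --> X]subr0; apply: cvgB; [exact: cvg_std_cdf | exact: std_pdf_decay].
Qed.

Lemma even_moments :
  (\int[mu]_x (x ^+ 2 * pdf x)%:E = 1)%E /\
  (\int[mu]_x (x ^+ 4 * pdf x)%:E = 3%:E)%E.
Proof.
have cX k : continuous (fun x : R => x ^+ k * pdf x).
  by move=> x; apply: cvgM; [exact: exprn_continuous|exact: continuous_std_pdf].
have half (f : R -> R) : (forall x : R, 0 <= f x) -> continuous f -> f =1 f \o -%R ->
    (\int[mu]_x (f x)%:E = 2%:E * \int[mu]_(x in `[0%R, +oo[) (f x)%:E)%E.
  by move=> f0 cf fe; rewrite ge0_symfun_integralT // set_itvcy.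
have pdf0 x : 0 <= pdf x := normal_pdf_ge0 0 1 x.
have [m0 m2 m4] := half_line_moments.
have c_half : 2 * (1 - std_cdf 0) = 1.
  have := half _ pdf0 continuous_std_pdf (fun x => esym (std_pdfN x)).
  by rewrite integral_normal_pdf m0 -EFinM => -[].
split; rewrite half ?m2 ?m4 -?EFinM //.
- by rewrite c_half.
- by move=> x; rewrite mulr_ge0 ?sqr_ge0.
- by move=> x; rewrite /= sqrrN std_pdfN.
- by rewrite mulrCA c_half mulr1.
- by move=> x; rewrite mulr_ge0 // exprn_even_ge0.
- by move=> x; rewrite /= std_pdfN [in RHS]exprNn -signr_odd expr0 mul1r.
Qed.

Import HBNNSimple.

(** Nonnegative functions are increasing limits of simple functions, for which
    the formula is the definition of the law. *)
Lemma ge0_integral_normal_prob (f : R -> R) : measurable_fun [set: R] f ->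
  (forall x, 0 <= f x) ->
  (\int[normal_prob 0 1]_x (f x)%:E = \int[mu]_x (f x * pdf x)%:E)%E.
Proof.
move=> mf f0; have pdf0 x : 0 <= pdf x := normal_pdf_ge0 0 1 x.
have mpdf : measurable_fun [set: R] pdf := measurable_normal_pdf 0 1.
have mEf : measurable_fun [set: measurableTypeR R] (fun x => (f x)%:E) by exact/measurable_EFinP.
pose f_ := nnsfun_approx measurableT mEf.
have f_f x : (f_ n x)%:E @[n --> \oo] --> (f x)%:E.
  by apply: (cvg_nnsfun_approx measurableT mEf) => // y _; rewrite lee_fin.
have nd_f m n x : (m <= n)%N -> f_ m x <= f_ n x.
  by move=> mn; have /lefP := nd_nnsfun_approx measurableT mEf mn; apply.
transitivity (limn (fun n => \int[normal_prob 0 1]_x (f_ n x)%:E))%E.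
  rewrite -monotone_convergence//.
  - by apply: eq_integral => x _; apply/esym/cvg_lim.
  - by move=> n; apply/measurable_EFinP; exact: (measurable_funPT (f_ n)).
  - by move=> n x _; rewrite lee_fin.
  - by move=> x _ m n mn; rewrite lee_fin; exact: nd_f.
transitivity (limn (fun n => \int[mu]_x (f_ n x * pdf x)%:E))%E; last first.
  rewrite -monotone_convergence//.
  - apply: eq_integral => x _; apply/cvg_lim => //.
    under eq_fun do rewrite EFinM; rewrite EFinM.
    by apply: cvgeZr.
  - by move=> n; apply/measurable_EFinP; apply: measurable_funM => //; exact: (measurable_funPT (f_ n)).
  - by move=> n x _; rewrite lee_fin mulr_ge0.
  - move=> x _ m n mn; rewrite lee_fin ler_wpM2r //.
    exact: nd_f.
congr (limn _); apply/funext => n.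
have mA r : measurable (f_ n @^-1` [set r]) by exact: measurable_funPTI.
have term0 r x : 0 <= r * \1_(f_ n @^-1` [set r]) x * pdf x.
  rewrite mulr_ge0 // -lee_fin EFinM.
  exact: nnfun_muleindic_ge0.
have mterm r : measurable_fun [set: measurableTypeR R]
    (fun x => (r * \1_(f_ n @^-1` [set r]) x * pdf x)%:E).
  apply/measurable_EFinP/measurable_funM => //; exact: measurable_funM.
rewrite integralT_nnsfun sintegralE.
transitivity (\sum_(r \in range (f_ n))
    \int[mu]_x (r * \1_(f_ n @^-1` [set r]) x * pdf x)%:E)%E.
  apply: eq_fsbigr => r; rewrite inE => -[x _ <-{r}].
  have fx0 : 0 <= f_ n x by [].
  transitivity ((f_ n x)%:E *
      \int[mu]_(y in f_ n @^-1` [set f_ n x]) (pdf y)%:E)%E; first by [].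
  rewrite [in LHS]integral_mkcond.
  transitivity (\int[mu]_y
      ((f_ n x)%:E * (\1_(f_ n @^-1` [set f_ n x]) y * pdf y)%:E))%E; last first.
    by apply: eq_integral => y _; rewrite -EFinM mulrA.
  rewrite ge0_integralZl //.
  - by congr *%E; apply: eq_integral => y _; rewrite patchE indicE; case: ifPn; rewrite ?mul1r ?mul0r.
  - by apply/measurable_EFinP/measurable_funM.
  - by move=> y _; rewrite lee_fin mulr_ge0.
rewrite -ge0_integral_fsum //; last by move=> r x _; rewrite lee_fin term0.
by apply: eq_integral => x _; rewrite fsumEFin// -mulr_fsuml -fimfunE.
Qed.

Lemma ge0_integral_normal_probN (f : R -> R) : measurable_fun [set: R] f ->
  (forall x, 0 <= f x) ->
  (\int[normal_prob 0 1]_x (f (- x))%:E = \int[normal_prob 0 1]_x (f x)%:E)%E.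
Proof.
move=> mf f0; have pdf0 x : 0 <= pdf x := normal_pdf_ge0 0 1 x.
have mpdf : measurable_fun [set: R] pdf := measurable_normal_pdf 0 1.
have mN : measurable_fun [set: measurableTypeR R] (-%R : R -> measurableTypeR R).
  exact: oppr_measurable.
rewrite !ge0_integral_normal_prob //; last exact: (measurableT_comp mf mN).
transitivity (\int[mu]_x (((fun y => (f y * pdf y)%:E) \o
    (-%R : R -> measurableTypeR R)) x))%E.
  by apply: eq_integral => x _; rewrite /= std_pdfN.
rewrite -[setT](@preimage_setT _ _ (-%R : R -> measurableTypeR R)).
rewrite -ge0_integral_pushforward //.
- by apply: eq_measure_integral => /= A mA _; exact: lebesgue_measureN.
- by apply/measurable_EFinP/measurable_funM.
- by move=> x _; rewrite lee_fin mulr_ge0.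
Qed.

Lemma measurable_poly4 (p0 p1 p2 p3 p4 : R) : measurable_fun [set: R]
  (fun x => p0 + p1 * x + p2 * x ^+ 2 + p3 * x ^+ 3 + p4 * x ^+ 4).
Proof.
have mX k : measurable_fun [set: R] (fun x : R => x ^+ k) by exact: measurable_funX.
apply: measurable_funD; last exact: measurable_funM.
apply: measurable_funD; last exact: measurable_funM.
apply: measurable_funD; last exact: measurable_funM.
by apply: measurable_funD => //; exact: measurable_funM.
Qed.

(** Averaging p over x and - x, which leaves the integral unchanged by symmetry
    of the law, cancels the odd powers. *)
Lemma integral_normal_poly4 (p0 p1 p2 p3 p4 : R) :
  let p x := p0 + p1 * x + p2 * x ^+ 2 + p3 * x ^+ 3 + p4 * x ^+ 4 in
  (forall x, 0 <= p x) ->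
  (\int[normal_prob 0 1]_x (p x)%:E = (p0 + p2 + 3 * p4)%:E)%E.
Proof.
move=> p pge0; have [m2 m4] := even_moments.
have mX k : measurable_fun [set: R] (fun x : R => x ^+ k) by exact: measurable_funX.
have mp : measurable_fun [set: R] p.
  exact: measurable_poly4.
have mN : measurable_fun [set: measurableTypeR R] (-%R : R -> measurableTypeR R).
  exact: oppr_measurable.
have E2 : (\int[normal_prob (0 : R) 1]_x (x ^+ 2)%:E = 1%:E)%E.
  exact: etrans (ge0_integral_normal_prob (mX 2%N) (@sqr_ge0 R)) m2.
have E4 : (\int[normal_prob (0 : R) 1]_x (x ^+ 4)%:E = 3%:E)%E.
  apply: etrans (ge0_integral_normal_prob (mX 4%N) _) m4 => x.
  exact: exprn_even_ge0.
have intX k : ~~ odd k -> (\int[normal_prob (0 : R) 1]_x (x ^+ k : R)%:E < +oo)%E ->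
    (normal_prob (0 : R) 1).-integrable setT (fun x => (x ^+ k)%:E).
  move=> ek fin; apply/integrableP; split; first by apply/measurable_EFinP.
  under eq_integral do rewrite /= ger0_norm ?exprn_even_ge0 //.
  exact: fin.
have i2 : (normal_prob (0 : R) 1).-integrable setT (fun x => (x ^+ 2)%:E).
  by apply: intX => //; rewrite E2 ltry.
have i4 : (normal_prob (0 : R) 1).-integrable setT (fun x => (x ^+ 4)%:E).
  by apply: intX => //; rewrite E4 ltry.
have : (\int[normal_prob 0 1]_x (p x)%:E + \int[normal_prob 0 1]_x (p x)%:E =
    (2 * (p0 + p2 + 3 * p4))%:E)%E.
  rewrite -{2}ge0_integral_normal_probN // -ge0_integralD //; last 4 first.
  - by move=> x _; rewrite lee_fin.
  - exact/measurable_EFinP.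
  - by move=> x _; rewrite lee_fin.
  - by apply/measurable_EFinP; exact: (measurableT_comp mp mN).
  transitivity (\int[normal_prob (0 : R) 1]_x ((2 * p0)%:E +
      ((2 * p2)%:E * (x ^+ 2)%:E + (2 * p4)%:E * (x ^+ 4)%:E)))%E.
    by apply: eq_integral => x _; rewrite -!EFinM -!EFinD; congr EFin; rewrite /p; ring.
  rewrite integralD //; last 2 first.
  - exact: finite_measure_integrable_cst.
  - by apply: integrableD => //; exact: integrableZl.
  rewrite integralD //; try exact: integrableZl.
  rewrite !integralZl // E2 E4 integral_cst //.
  rewrite [X in (_ * X)%E](@probability_setT _ _ _ (normal_prob (0 : R) 1 : probability _ R)).
  by rewrite -!EFinM -!EFinD; congr EFin; ring.
have : (0 <= \int[normal_prob 0 1]_x (p x)%:E)%E by apply: integral_ge0 => x _; rewrite lee_fin.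
move: (\int[normal_prob 0 1]_x (p x)%:E)%E => [r _|//|//].
by rewrite -EFinD => -[rr]; congr EFin; lra.
Qed.

End GaussianDensity.

(** * Quadratic polynomials of independent normal variables *)
Section IidTuple.
Context {d : measure_display} {T : measurableType d} {R : realType}.
Variable nu : probability T R.

Definition tuple_cons n (p : T * n.-tuple T) : n.+1.-tuple T :=
  [tuple of p.1 :: p.2].

Lemma measurable_tuple_cons n : measurable_fun setT (@tuple_cons n).
Proof. exact: measurable_cons. Qed.

HB.instance Definition _ n :=
  isMeasurableFun.Build _ _ _ _ (@tuple_cons n) (@measurable_tuple_cons n).

(** The law of n independent draws from nu, one coordinate at a time: integrals
    against it reduce to iterated integrals by induction on n. *)
Fixpoint iid_prob (n : nat) : probability (n.-tuple T) R :=
  match n with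
  | 0 => \d_([tuple] : 0.-tuple T) : probability _ R
  | n'.+1 => distribution ((nu \x iid_prob n')%E : probability (T * n'.-tuple T)%type R)
               (@tuple_cons n' : {mfun (T * n'.-tuple T)%type >-> n'.+1.-tuple T})
  end.

Definition box n (A : 'I_n -> set T) : set (n.-tuple T) :=
  [set z | forall i, A i (tnth z i)].

Lemma measurable_box n (A : 'I_n -> set T) :
  (forall i, measurable (A i)) -> measurable (box A).
Proof.
move=> mA; have -> : box A = \bigcap_i ((@tnth n T ^~ i) @^-1` A i).
  by apply/seteqP; split=> [z Az i _|z Az i]; exact: Az.
apply: fin_bigcap_measurable => [|i _]; first exact: finite_finset.
by rewrite -[X in measurable X]setTI; exact: measurable_tnth.
Qed.

Lemma iid_prob_box n (A : 'I_n -> set T) : (forall i, measurable (A i)) ->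
  (iid_prob n (box A) = \prod_(i < n) nu (A i))%E.
Proof.
elim: n A => [|n IHn] A mA /=.
  by rewrite big_ord0 diracE mem_set // => -[].
rewrite big_ord_recl -IHn // -product_measure1E //; last exact: measurable_box.
rewrite /distribution /pushforward; congr (_ _).
apply/seteqP; split=> -[x z] /=.
  move=> Axz; split=> [|i] /=; first by have := Axz ord0; rewrite (tnth_nth x).
  by have := Axz (lift ord0 i); rewrite /tuple_cons /= tnthS.
move=> [Ax Az] i; case: (unliftP ord0 i) => [j|] ->.
  by rewrite /tuple_cons tnthS; exact: Az.
by rewrite (tnth_nth x).
Qed.

Lemma ge0_integral_iid_probS n (f : n.+1.-tuple T -> \bar R) :
  measurable_fun setT f -> (forall z, 0 <= f z)%E ->
  (\int[iid_prob n.+1]_z f z =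
   \int[nu]_x \int[iid_prob n]_z f [tuple of x :: z])%E.
Proof.
move=> mf f0; rewrite /= ge0_integral_distribution //.
rewrite fubini_tonelli1 //.
  exact: (measurableT_comp mf (@measurable_tuple_cons n)).
by move=> z; exact: f0.
Qed.

End IidTuple.

Section QuadraticMoments.
Context {R : realType}.

Definition std_normal : probability R R :=
  distribution (normal_prob 0 1 : probability _ R) (@idTR R).

Definition quad n (a : 'I_n -> 'I_n -> R) (b : 'I_n -> R) (c : R)
    (z : n.-tuple R) : R :=
  \sum_i \sum_j a i j * (tnth z i * tnth z j) + \sum_i b i * tnth z i + c.

Lemma measurable_quad n a b c : measurable_fun setT (@quad n a b c).
Proof.
apply: measurable_funD => //; apply: measurable_funD.
  apply: measurable_sum => i; apply: measurable_sum => j.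
  apply: measurable_funM => //; apply: measurable_funM; exact: measurable_tnth.
apply: measurable_sum => i; apply: measurable_funM => //; exact: measurable_tnth.
Qed.

(** As a function of the last coordinates, a quadratic polynomial is again one,
    with linear and constant terms depending on the first coordinate: the family
    is stable under the induction on the dimension. *)
Lemma quad_cons n (a : 'I_n.+1 -> 'I_n.+1 -> R) b c x (z : n.-tuple R) :
  (forall i j, a i j = a j i) ->
  quad a b c [tuple of x :: z] =
  quad (fun i j => a (lift ord0 i) (lift ord0 j))
       (fun i => b (lift ord0 i) + 2 * x * a ord0 (lift ord0 i))
       (c + b ord0 * x + a ord0 ord0 * x ^+ 2) z.
Proof.
move=> asym; have t0 : tnth [tuple of x :: z] ord0 = x by rewrite (tnth_nth x).
rewrite /quad !big_ord_recl t0.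
under [X in _ + X + _ + _]eq_bigr do rewrite big_ord_recl tnthS t0.
rewrite big_split /=.
under [X in a ord0 ord0 * _ + X]eq_bigr do rewrite tnthS.
under [X in b ord0 * x + X]eq_bigr do rewrite tnthS.
under [X in _ = _ + X + _]eq_bigr do rewrite mulrDl.
rewrite big_split /=.
under [X in _ + (_ + X) + _ + _ = _]eq_bigr do under eq_bigr do rewrite tnthS.
have -> : \sum_(i < n) a (lift ord0 i) ord0 * (tnth z i * x) =
    \sum_(i < n) a ord0 (lift ord0 i) * (x * tnth z i).
  by apply: eq_bigr => i _; rewrite asym (mulrC x).
have -> : \sum_(i < n) 2 * x * a ord0 (lift ord0 i) * tnth z i =
    2 * \sum_(i < n) a ord0 (lift ord0 i) * (x * tnth z i).
  by rewrite mulr_sumr; apply: eq_bigr => i _; ring.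
ring.
Qed.

(** Isserlis' formula, by induction on the dimension: integrating out the last
    coordinates leaves a polynomial of degree four in the first one, whose
    integral only involves the moments of the standard normal law. *)
Lemma quad_second_moment n (a : 'I_n -> 'I_n -> R) b c :
  (forall i j, a i j = a j i) ->
  (\int[iid_prob std_normal n]_z (quad a b c z ^+ 2)%:E =
   ((\sum_i a i i + c) ^+ 2 + 2 * (\sum_i \sum_j a i j ^+ 2)
     + \sum_i b i ^+ 2)%:E)%E.
Proof.
elim: n a b c => [|n IHn] a b c asym.
  rewrite /= integral_dirac //.
    by rewrite diracT mul1e /quad !big_ord0 !add0r mulr0 !addr0.
  by apply/measurable_EFinP/measurable_funX; exact: measurable_quad.
rewrite ge0_integral_iid_probS.
- under eq_integral.
    move=> x _; under eq_integral do rewrite quad_cons //.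
    rewrite IHn => [|i j]; last by rewrite asym.
    over.
  set t := \sum_i a (lift ord0 i) (lift ord0 i).
  set s2 := \sum_i \sum_j a (lift ord0 i) (lift ord0 j) ^+ 2.
  set r2 := \sum_(i < n) a ord0 (lift ord0 i) ^+ 2.
  set b2 := \sum_(i < n) b (lift ord0 i) ^+ 2.
  set ab := \sum_(i < n) b (lift ord0 i) * a ord0 (lift ord0 i).
  pose p x := ((t + c) ^+ 2 + 2 * s2 + b2)
    + (2 * (t + c) * b ord0 + 4 * ab) * x
    + (b ord0 ^+ 2 + 2 * (t + c) * a ord0 ord0 + 4 * r2) * x ^+ 2
    + (2 * b ord0 * a ord0 ord0) * x ^+ 3 + a ord0 ord0 ^+ 2 * x ^+ 4.
  have pE x : (t + (c + b ord0 * x + a ord0 ord0 * x ^+ 2)) ^+ 2 + 2 * s2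
      + \sum_i (b (lift ord0 i) + 2 * x * a ord0 (lift ord0 i)) ^+ 2 = p x.
    have -> : \sum_i (b (lift ord0 i) + 2 * x * a ord0 (lift ord0 i)) ^+ 2 =
        b2 + (4 * x * ab + 4 * x ^+ 2 * r2).
      rewrite /b2 /ab /r2 !mulr_sumr -!big_split /=.
      by apply: eq_bigr => i _; ring.
    by rewrite /p; ring.
  have p0 x : 0 <= p x.
    rewrite -pE addr_ge0 ?addr_ge0 ?sqr_ge0 ?mulr_ge0 //.
      by apply: sumr_ge0 => i _; apply: sumr_ge0 => j _; exact: sqr_ge0.
    by apply: sumr_ge0 => i _; exact: sqr_ge0.
  transitivity (\int[std_normal]_x (p x)%:E)%E.
    by apply: eq_integral => x _; rewrite pE.
  transitivity (\int[normal_prob 0 1]_x (p x)%:E)%E.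
    rewrite /std_normal ge0_integral_distribution //.
      by apply/measurable_EFinP; exact: measurable_poly4.
  rewrite integral_normal_poly4 //; congr EFin.
  rewrite !big_ord_recl.
  under [X in _ = _ + 2 * (_ + X) + _]eq_bigr do rewrite big_ord_recl asym.
  rewrite big_split /= -/t -/s2 -/r2 -/b2; ring.
- by apply/measurable_EFinP/measurable_funX; exact: measurable_quad.
- by move=> z; rewrite lee_fin sqr_ge0.
Qed.

End QuadraticMoments.

(** * Power of the test based on one smoother *)
Section Power.
Context {R : realType}.

(** Chebyshev's inequality: the mean of the polynomial is the trace plus the
    constant term, and its variance is given by Isserlis' formula. *)
Lemma quad_lower_tail n (a : 'I_n -> 'I_n -> R) b c (t : R) :
  (forall i j, a i j = a j i) -> \sum_i a i i + c = 0 -> 0 < t ->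
  (iid_prob std_normal n [set z | (quad a b c z <= - t)%R] <=
   ((2 * (\sum_i \sum_j a i j ^+ 2) + \sum_i b i ^+ 2) / t ^+ 2)%:E)%E.
Proof.
move=> asym tr0 t0; set A := [set z | _].
have mq : measurable_fun setT (quad a b c) := measurable_quad a b c.
have mq2 : measurable_fun setT (fun z => (quad a b c z ^+ 2)%:E).
  by apply/measurable_EFinP/measurable_funX.
have mA : measurable A.
  rewrite (_ : A = quad a b c @^-1` [set` `]-oo, - t]]).
    by rewrite -[X in measurable X]setTI; exact: mq.
  by apply/seteqP; split=> z; rewrite /A /= in_itv.
have t20 : 0 < t ^+ 2 by rewrite exprn_gt0.
rewrite mulrC EFinM lee_pdivlMl // -integral_cst //.
have -> : (2 * (\sum_i \sum_j a i j ^+ 2) + \sum_i b i ^+ 2)%:E =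
    (\int[iid_prob std_normal n]_z (quad a b c z ^+ 2)%:E)%E.
  by rewrite quad_second_moment // tr0 expr0n add0r.
apply: (@le_trans _ _ (\int[iid_prob std_normal n]_(z in A)
    (quad a b c z ^+ 2)%:E)%E).
  apply: ge0_le_integral => //.
  - by move=> z _; rewrite lee_fin ltW.
  - exact: measurable_funTS.
  - move=> z Az; rewrite lee_fin -[quad _ _ _ z ^+ 2]sqrrN.
    have tz : t <= - quad a b c z by rewrite lerNr.
    by rewrite lerXn2r ?nnegrE ?(ltW t0) // (le_trans (ltW t0)).
apply: ge0_subset_integral => //.
by move=> z _; rewrite lee_fin sqr_ge0.
Qed.

Lemma mxtrace_mul_tr n (A : 'M[R]_n) :
  \tr (A *m A^T) = \sum_i \sum_j A i j ^+ 2.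
Proof.
apply: eq_bigr => i _; rewrite mxE; apply: eq_bigr => j _.
by rewrite mxE expr2.
Qed.

Definition noisy n (f : 'cV[R]_n) (z : n.-tuple R) : 'cV[R]_n :=
  \col_i (f i 0 + tnth z i).

Lemma quadform_noisy n (A : 'M[R]_n) (f : 'cV[R]_n) (z : n.-tuple R) : A^T = A ->
  ((noisy f z)^T *m A *m noisy f z) 0 0 - \tr A =
    (f^T *m A *m f) 0 0 +
      quad (fun i j => A i j) (fun i => 2 * (A *m f) i 0) (- \tr A) z.
Proof.
move=> Asym; pose zc := \col_i tnth z i.
have -> : noisy f z = f + zc by apply/colP => i; rewrite !mxE.
rewrite quadformD // /quad.
have -> : (zc^T *m A *m zc) 0 0 = \sum_i \sum_j A i j * (tnth z i * tnth z j).
  rewrite -mulmxA mxE; apply: eq_bigr => i _.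
  rewrite !mxE mulr_sumr; apply: eq_bigr => j _.
  by rewrite !mxE mulrCA.
have -> : 2 * (f^T *m A *m zc) 0 0 = \sum_i 2 * (A *m f) i 0 * tnth z i.
  rewrite quadform_sym // -mulmxA mxE mulr_sumr; apply: eq_bigr => i _.
  by rewrite !mxE -mulrA [_ * tnth z i]mulrC.
ring.
Qed.

(** Power of the test based on one smoother D: as soon as the signal
    F = |D f|^2 dominates the threshold t times the standard deviation, the
    statistic exceeds t outside of an event whose probability is controlled by
    Chebyshev's inequality. *)
Lemma stat_tau_power n (D : 'M[R]_n) (f : 'cV[R]_n) (t : R) :
  (0 < n)%N -> D^T = D -> psd (1%:M - D ^+ 2) ->
  let F := (f^T *m D ^+ 2 *m f) 0 0 in let V := \tr (D ^+ 4) in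
  0 < F -> 0 <= t -> 2 * (t * Num.sqrt (2 * V)) <= F ->
  ((1 - (8 * V + 16 * F) / F ^+ 2)%:E <=
   iid_prob std_normal n [set z | (t <= stat_tau D (noisy f z))%R])%E.
Proof.
move=> n0 Dsym D1 F V F0 t0 tF.
have D2sym : (D ^+ 2)^T = D ^+ 2 by rewrite expr2 -mulmxE trmx_mul Dsym.
have D4E : D ^+ 4 = D ^+ 2 *m (D ^+ 2)^T.
  by rewrite D2sym (exprD _ 2 2) mulmxE.
have VE : V = \sum_i \sum_j (D ^+ 2) i j ^+ 2.
  by rewrite /V D4E mxtrace_mul_tr.
(* The variance vanishes only if D^2 does, which the signal excludes. *)
have V0 : 0 < V.
  have Vge0 : 0 <= V.
    by rewrite VE; do 2! apply: sumr_ge0 => ? _; exact: sqr_ge0.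
  rewrite lt_neqAle Vge0 andbT eq_sym; apply: contraPneq F0 => V0.
  suff D20 : D ^+ 2 = 0 by rewrite /F D20 mulmx0 mul0mx mxE ltxx.
  apply/matrixP => i j; rewrite [RHS]mxE; apply/eqP; rewrite -sqrf_eq0; apply/eqP.
  rewrite VE in V0.
  have row0 : \sum_j (D ^+ 2) i j ^+ 2 = 0.
    by apply: (psumr_eq0P _ V0) => // k _; apply: sumr_ge0 => l _; exact: sqr_ge0.
  by apply: (psumr_eq0P _ row0) => // l _; exact: sqr_ge0.
set a := fun i j => (D ^+ 2) i j; set b := fun i => 2 * (D ^+ 2 *m f) i 0.
have asym i j : a i j = a j i by rewrite /a -[in LHS]D2sym mxE.
have b2 : \sum_i b i ^+ 2 <= 4 * F.
  have -> : \sum_i b i ^+ 2 = 4 * ((D ^+ 2 *m f)^T *m (D ^+ 2 *m f)) 0 0.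
    rewrite dotmx_sum mulr_sumr; apply: eq_bigr => i _.
    by rewrite /b exprMn -natrX.
  rewrite ler_pM2l // -subr_ge0; have := D1 (D *m f).
  rewrite mulmxBr mulmxBl mulmx1 [X in 0 <= X -> _]mxE [X in _ + X]mxE.
  rewrite [(D ^+ 2 *m f)^T]trmx_mul D2sym [(D *m f)^T]trmx_mul Dsym /F.
  by rewrite expr2 -mulmxE !mulmxA.
have tauE z : stat_tau D (noisy f z) =
    (F + quad a b (- \tr (D ^+ 2)) z) / Num.sqrt (2 * V).
  rewrite /stat_tau /stat_T mulVKf ?pnatr_eq0 -?lt0n //.
  by rewrite quadform_noisy.
have mq : measurable_fun setT (quad a b (- \tr (D ^+ 2))) :=
  measurable_quad a b _.
have sV0 : 0 < Num.sqrt (2 * V) by rewrite sqrtr_gt0 mulr_gt0.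
pose A := [set z : n.-tuple R | quad a b (- \tr (D ^+ 2)) z <= - (F / 2)].
have mA : measurable A.
  rewrite (_ : A = quad a b (- \tr (D ^+ 2)) @^-1` [set` `]-oo, - (F / 2)]]).
    by rewrite -[X in measurable X]setTI; exact: mq.
  by apply/seteqP; split=> z; rewrite /A /= in_itv.
have PA : (iid_prob std_normal n A <= ((8 * V + 16 * F) / F ^+ 2)%:E)%E.
  apply: le_trans (@quad_lower_tail n a b (- \tr (D ^+ 2)) (F / 2) asym _ _) _.
  - exact: subrr.
  - by rewrite divr_gt0.
  rewrite lee_fin -VE.
  have -> : (2 * V + \sum_i b i ^+ 2) / (F / 2) ^+ 2 =
      (8 * V + 4 * \sum_i b i ^+ 2) / F ^+ 2 by field; rewrite gt_eqF.
  by rewrite ler_pM2r ?invr_gt0 ?exprn_gt0 // lerD2l; lra.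
apply: (@le_trans _ _ (iid_prob std_normal n (~` A))).
  rewrite probability_setC // EFinB; exact: leeB.
apply: le_measure; rewrite ?inE; first exact: measurableC.
  under eq_set do rewrite tauE.
  rewrite (_ : [set z | _] = (fun z => (F + quad a b (- \tr (D ^+ 2)) z) /
      Num.sqrt (2 * V)) @^-1` [set` `[t, +oo[]).
    rewrite -[X in measurable X]setTI; apply: measurable_funM => //.
    exact: measurable_funD.
  by apply/seteqP; split=> z; rewrite /= in_itv /= andbT.
move=> z /=; rewrite /A /= => /negP; rewrite -ltNge tauE ler_pdivlMr // => qz.
lra.
Qed.

End Power.

(** * Conditional law of the noise given the design *)
Section TupleUniqueness.
Context {R : realType}.

Definition qbox n (q : {ffun 'I_n -> rat}) : set (n.-tuple R) :=
  [set z | forall i, tnth z i <= ratr (q i)].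

Definition qray (p : rat) : set R := [set r | r <= ratr p].

Lemma measurable_qray p : measurable (qray p).
Proof.
rewrite (_ : qray p = [set` `]-oo, ratr p]]); first exact: measurable_itv.
by apply/seteqP; split=> r; rewrite /qray /= in_itv.
Qed.

Lemma qboxE n (q : {ffun 'I_n -> rat}) : qbox q = box (fun i => qray (q i)).
Proof. by []. Qed.

Lemma measurable_qbox n (q : {ffun 'I_n -> rat}) : measurable (qbox q).
Proof. by rewrite qboxE; apply: measurable_box => i; exact: measurable_qray. Qed.

Lemma tuple_le_nat n (z : n.-tuple R) : exists k : nat, forall j, tnth z j <= k%:R.
Proof.
exists (\max_j Num.truncn (tnth z j)).+1 => j.
apply/ltW; apply: lt_le_trans (truncnS_gt _) _; rewrite ler_nat ltnS.
exact: (leq_bigmax j).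
Qed.

(** Half-spaces are countable unions of rational boxes. *)
Lemma measurable_tnth_qbox n (i : 'I_n) (A : set R) : measurable A ->
  <<s range (@qbox n) >> (@tnth n R ^~ i @^-1` A).
Proof.
move=> mA; pose Tq := g_sigma_algebraType (range (@qbox n)).
suff mt : measurable_fun [set: Tq] (fun z : Tq => tnth (z : n.-tuple R) i).
  by have := mt measurableT A mA; rewrite setTI.
apply: (measurability _ (RGenInftyO.measurableE R)) => //.
move=> _ [_ [x ->] <-]; rewrite setTI.
pose F (p : rat * nat) : set Tq := if ratr p.1 < x
  then qbox [ffun j => if j == i then p.1 else p.2%:R] else set0.
have -> : (fun z : Tq => tnth (z : n.-tuple R) i) @^-1` `]-oo, x[ = \bigcup_p F p.
  apply/seteqP; split=> z; rewrite /= in_itv /=; last first.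
    move=> [[q k] _]; rewrite /F /=; case: ifP => // qx /(_ i).
    by rewrite /= ffunE eqxx => zq; exact: le_lt_trans qx.
  move=> zx; have [q] := rat_in_itvoo zx; rewrite in_itv /= => /andP[zq qx].
  have [k kz] := tuple_le_nat (z : n.-tuple R).
  exists (q, k) => //; rewrite /F /= qx => j; rewrite ffunE.
  by case: eqP => [->|_]; rewrite ?(ltW zq) // ratr_nat.
apply: countable_bigcupT_measurable => // p; rewrite /F; case: ifP => // _.
by apply: sub_sigma_algebra; exists [ffun j => if j == i then p.1 else p.2%:R].
Qed.

Lemma measurable_tuple_qbox n :
  @measurable _ (n.-tuple R) = <<s range (@qbox n) >>.
Proof.
apply/seteqP; split=> A; last first.
  apply: smallest_sub; first exact: sigma_algebra_measurable.
  by move=> _ [q _ <-]; exact: measurable_qbox.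
apply: smallest_sub; first exact: smallest_sigma_algebra.
move=> B; rewrite -bigcup_seq => -[i _ [C mC <-]]; rewrite setTI.
exact: measurable_tnth_qbox.
Qed.

(** A probability on n-tuples is determined by its values on the countably many
    rational boxes, which form a pi-system. *)
Lemma eq_probability_qbox n (m1 m2 : probability (n.-tuple R) R) :
  (forall q : {ffun 'I_n -> rat}, m1 (qbox q) = m2 (qbox q)) ->
  forall A, measurable A -> m1 A = m2 A.
Proof.
move=> m12 A mA.
apply: (measure_unique (range (@qbox n)) (fun k => qbox [ffun=> k%:R])) => //.
- exact: measurable_tuple_qbox.
- move=> _ _ [q _ <-] [r _ <-]; exists [ffun i => Num.min (q i) (r i)] => //.
  apply/seteqP; split=> z.
    move=> zqr; split=> i; have := zqr i; rewrite ffunE => /le_trans; apply;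
    by rewrite ler_rat ge_min lexx ?orbT.
  by move=> [zq zr] i; rewrite ffunE; rewrite minElt; case: ifP.
- apply/seteqP; split=> // z _; have [k kz] := tuple_le_nat z.
  by exists k => // i; rewrite ffunE ratr_nat.
- by move=> _ [q _ <-]; exact: m12.
- by move=> k; rewrite (le_lt_trans (probability_le1 _ _)) ?ltry //; exact: measurable_qbox.
Qed.

End TupleUniqueness.

Section ConditionalLaw.
Context {dO : measure_display} {Omega : measurableType dO} {R : realType}.
Variable P : probability Omega R.

(** A conditional probability given G of an event whose probability is not
    affected by G is almost surely constant: compare its integrals over the sets
    of G where it exceeds, resp. falls below, that probability. *)
Lemma is_cond_prob_indep (G : set (set Omega)) (E : set Omega) (g : Omega -> R) :
  G `<=` measurable -> measurable E -> is_cond_prob P G E g ->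
  (forall w, 0 <= g w <= 1) ->
  (forall D, G D -> P (E `&` D) = (P E * P D)%E) ->
  P.-negligible [set w | (g w)%:E <> P E].
Proof.
move=> GM mE [Gg intg] g01 indep.
have pE : P E = (fine (P E))%:E by rewrite fineK // fin_num_measure.
set p := fine (P E) in pE.
have mg : measurable_fun setT g.
  by move=> _ B mB; rewrite setTI; apply/GM/Gg.
have icst (r : R) D : measurable D -> P.-integrable D (fun=> r%:E).
  by move=> mD; exact: finite_measure_integrable_cst.
have ig D : measurable D -> P.-integrable D (fun w => (g w)%:E).
  move=> mD; apply: (le_integrable mD _ _ (icst 1 D mD)).
    by apply/measurable_EFinP; exact: measurable_funTS.
  by move=> w _; case/andP: (g01 w) => g0 g1; rewrite !gee0_abs ?lee_fin.
have int0 D : G D -> (\int[P]_(w in D) ((g w)%:E - p%:E) = 0)%E /\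
    (\int[P]_(w in D) (p%:E - (g w)%:E) = 0)%E.
  move=> GD; have mD := GM _ GD.
  rewrite (integralB mD (ig _ mD) (icst p _ mD)).
  rewrite (integralB mD (icst p _ mD) (ig _ mD)) intg // indep // integral_cst //.
  by rewrite pE subee // fin_numM // fin_num_measure.
have null (D : set Omega) (h : Omega -> \bar R) : measurable D ->
    measurable_fun D h -> (forall w, D w -> 0 < h w)%E ->
    (\int[P]_(w in D) h w = 0)%E -> P.-negligible D.
  move=> mD mh h0 ih; have := (ae_eq_integral_abs P mD mh).1.
  have -> : (\int[P]_(w in D) `|h w| = 0)%E.
    rewrite -[RHS]ih; apply: eq_integral => w; rewrite inE => Dw.
    by rewrite gee0_abs // ltW // h0.
  move=> /(_ erefl); apply: negligibleS => w Dw /= /(_ Dw) hw0.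
  by have := h0 w Dw; rewrite hw0 ltxx.
have GgE (B : set R) : measurable B -> G (g @^-1` B) by move=> mB; exact: Gg.
have mgB D : measurable D -> measurable_fun D (fun w => ((g w)%:E - p%:E)%E).
  by move=> mD; apply: emeasurable_funB => //; apply/measurable_EFinP/measurable_funTS.
have mgt : measurable [set r : R | p < r].
  by rewrite (_ : [set r | _] = [set` `]p, +oo[]) //; apply/seteqP; split=> r; rewrite /= in_itv /= andbT.
have mlt : measurable [set r : R | r < p].
  by rewrite (_ : [set r | _] = [set` `]-oo, p[]) //; apply/seteqP; split=> r; rewrite /= in_itv.
apply: (@negligibleS _ _ _ P ((g @^-1` [set r | p < r]) `|` (g @^-1` [set r | r < p]))).
  move=> w /=; rewrite pE; case: (ltgtP (g w) p) => [||->]; [by right|by left|by []].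
apply: negligibleU.
  apply: (null _ (fun w => (g w)%:E - p%:E)%E).
  - exact/GM/GgE.
  - exact/mgB/GM/GgE.
  - by move=> w /= pw; rewrite -EFinB lte_fin subr_gt0.
  - exact: (int0 _ (GgE _ mgt)).1.
apply: (null _ (fun w => p%:E - (g w)%:E)%E).
- exact/GM/GgE.
- apply: emeasurable_funB => //; apply/measurable_EFinP/measurable_funTS.
  exact: mg.
- by move=> w /= pw; rewrite -EFinB lte_fin subr_gt0.
- exact: (int0 _ (GgE _ mlt)).2.
Qed.

(** The exceptional set must not depend on the event: it is the union of those
    of the countably many rational boxes. *)
Lemma cond_distribution_iid n (G : set (set Omega))
    (eps : 'I_n -> {RV P >-> R}) (kappa : Omega -> probability (n.-tuple R) R) :
  G `<=` measurable ->
  iid_with_law (normal_prob 0 1 : set R -> \bar R) eps ->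
  independent_sigma P (g_sigma_preimage eps) G ->
  is_cond_distribution P G (noise_vec eps) kappa ->
  P.-negligible [set w | ~ forall A, measurable A ->
    kappa w A = iid_prob std_normal n A].
Proof.
move=> GM [mi law] indep cd.
have noiseE (q : {ffun 'I_n -> rat}) :
    noise_vec eps @^-1` qbox q = \bigcap_i (eps i @^-1` qray (q i)).
  apply/seteqP; split=> w /=.
    by move=> h i _; have := h i; rewrite /noise_vec tnth_mktuple.
  by move=> h i; rewrite /noise_vec tnth_mktuple; exact: h.
have PE (q : {ffun 'I_n -> rat}) :
    P (noise_vec eps @^-1` qbox q) = iid_prob std_normal n (qbox q).
  rewrite noiseE.
  rewrite mi => [|i]; last exact: measurable_qray.
  rewrite qboxE iid_prob_box => [|i]; last exact: measurable_qray.
  apply: eq_bigr => i _.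
  transitivity (distribution P (eps i) (qray (q i))); first by [].
  by rewrite law //; exact: measurable_qray.
pose N (q : {ffun 'I_n -> rat}) :=
  [set w | kappa w (qbox q) <> iid_prob std_normal n (qbox q)].
have negN q : P.-negligible (N q).
  have sE : (g_sigma_preimage eps) (noise_vec eps @^-1` qbox q).
    rewrite noiseE; pose Ts := g_sigma_algebraType
      (\big[setU/set0]_(i < n) preimage_set_system setT (eps i) measurable).
    apply: (@fin_bigcap_measurable _ Ts) => [|i _]; first exact: finite_finset.
    apply: sub_sigma_algebra; rewrite -bigcup_seq /=; exists i.
      by rewrite /= mem_index_enum.
    by exists (qray (q i)); [exact: measurable_qray | rewrite setTI].
  have mE : measurable (noise_vec eps @^-1` qbox q).
    rewrite noiseE; apply: fin_bigcap_measurable => [|i _]; first exact: finite_finset.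
    by apply: measurable_funPTI; exact: measurable_qray.
  have mq : measurable (@qbox R n q) := measurable_qbox q.
  apply: negligibleS (is_cond_prob_indep GM mE (cd _ mq) _
    (fun D => indep _ D sE)) => [w Nw e|w].
    by apply: Nw; rewrite -PE -e fineK // fin_num_measure.
  by rewrite fine_ge0 //= -lee_fin fineK ?fin_num_measure // probability_le1.
apply: (@negligibleS _ _ _ P (\bigcup_k oapp N set0 (unpickle k))).
  move=> w /= bad; apply: contrapT => nbad; apply: bad; apply: eq_probability_qbox => q.
  apply: contrapT => bad; apply: nbad; exists (pickle q) => //.
  by rewrite pickleK.
apply: negligible_bigcup => k; case: (unpickle k) => [q|] /=; first exact: negN.
exact: negligible_set0.
Qed.

End ConditionalLaw.

(** * Kernel matrices *)
Section Rkhs.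
Context {d : measure_display} {X : measurableType d} {R : realType}.
Variables (K : X -> X -> R) (H : set (X -> R)) (ip : (X -> R) -> (X -> R) -> R).
Hypothesis KH : is_rkhs K H ip.

Lemma rkhs_kernel_sym x y : K x y = K y x.
Proof.
rewrite -(rkhs_reproducing KH y (rkhs_kernel KH x)).
by rewrite (rkhs_ip_sym KH (rkhs_kernel KH x) (rkhs_kernel KH y))
  (rkhs_reproducing KH x (rkhs_kernel KH y)).
Qed.

Lemma rkhs_ip0 f : H f -> ip (fun=> 0) f = 0.
Proof.
move=> Hf; have H0 := rkhs0 KH; have := rkhs_ip_lin KH 1 H0 H0 Hf.
rewrite (_ : (fun x => 1 * 0 + 0) = fun=> 0); last first.
  by apply/funext => x; rewrite mulr0 addr0.
by rewrite mul1r => h; lra.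
Qed.

(** The Riesz representer of the functional sending f to the combination, with
    weights v, of its values at the points x. *)
Definition section_sum (I : Type) (r : seq I) (v : I -> R) (x : I -> X) : X -> R :=
  fun y => \sum_(i <- r) v i * K (x i) y.

Lemma section_sumP (I : Type) (r : seq I) (v : I -> R) (x : I -> X) :
  H (section_sum r v x) /\
  forall f, H f -> ip (section_sum r v x) f = \sum_(i <- r) v i * f (x i).
Proof.
elim: r => [|i r [Hr ipr]].
  have -> : section_sum [::] v x = fun=> 0.
    by apply/funext => y; rewrite /section_sum big_nil.
  by split=> [|f Hf]; [exact: rkhs0 KH | rewrite big_nil rkhs_ip0].
have -> : section_sum (i :: r) v x =
    fun y => v i * K (x i) y + section_sum r v x y.
  by apply/funext => y; rewrite /section_sum big_cons.
have HK := rkhs_kernel KH (x i).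
split=> [|f Hf]; first exact: rkhs_lin KH _ _ _ HK Hr.
rewrite (rkhs_ip_lin KH (v i) HK Hr Hf) big_cons ipr //.
by rewrite (rkhs_ip_sym KH HK Hf) (rkhs_reproducing KH).
Qed.

Variables (n : nat) (x : 'I_n -> X).

Lemma kernel_mx_sym : (kernel_mx K x)^T = kernel_mx K x.
Proof. by apply/matrixP => i j; rewrite !mxE rkhs_kernel_sym. Qed.

Let g (v : 'cV[R]_n) := section_sum (index_enum 'I_n) (fun i => v i 0) x.

Lemma section_sum_kernel_mx (v : 'cV[R]_n) i :
  g v (x i) = n%:R * (kernel_mx K x *m v) i 0.
Proof.
have n0 : n%:R != 0 :> R by rewrite pnatr_eq0 -lt0n (leq_ltn_trans _ (ltn_ord i)).
rewrite mxE mulr_sumr; apply: eq_bigr => j _.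
by rewrite mxE !mulrA divff // mul1r mulrC rkhs_kernel_sym.
Qed.

(** The quadratic form of the kernel matrix is a squared norm in the Hilbert
    space, whence its positivity. *)
Lemma kernel_mx_quadform (v : 'cV[R]_n) :
  ip (g v) (g v) = n%:R * (v^T *m kernel_mx K x *m v) 0 0.
Proof.
have [Hg ->] := section_sumP (index_enum 'I_n) (fun i => v i 0) x => //.
rewrite -mulmxA mxE mulr_sumr; apply: eq_bigr => i _.
by rewrite section_sum_kernel_mx [v^T _ _]mxE mulrCA.
Qed.

Lemma kernel_mx_psd : psd (kernel_mx K x).
Proof.
move=> v; have [n0|n0] := posnP n.
  rewrite mxE big1 // => i _; exfalso.
  by have := leq_ltn_trans (leq0n i) (ltn_ord i); rewrite n0.
rewrite -(@pmulr_rge0 _ n%:R) ?ltr0n // -kernel_mx_quadform.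
apply: (rkhs_ip_ge0 KH).
by have [] := section_sumP (index_enum 'I_n) (fun i => v i 0) x.
Qed.

(** The values of a function of H on the design lie in the range of the kernel
    matrix: a vector v in its kernel gives a combination of kernel sections of
    norm zero, hence the zero function, and v is orthogonal to the values. *)
Lemma eval_vec_range f : H f -> exists b, eval_vec f x = kernel_mx K x *m b.
Proof.
move=> Hf; have [|b bE] := @factor_through _ _ _ _ (eval_vec f x)^T (kernel_mx K x).
  move=> v Kv0; have [Hg ipg] := section_sumP (index_enum 'I_n) (fun i => v i 0) x.
  have g0 : g v = fun=> 0.
    apply: (rkhs_ip_eq0 KH) => //.
    by rewrite kernel_mx_quadform -mulmxA Kv0 mulmx0 mxE mulr0.
  apply/matrixP => i j; rewrite !ord1 [RHS]mxE.
  have := ipg f Hf; rewrite -/(g v) g0 rkhs_ip0 // => ->.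
  by rewrite mxE; apply: eq_bigr => k _; rewrite !mxE mulrC.
exists b^T; rewrite -[eval_vec f x]trmxK bE trmx_mul.
by rewrite kernel_mx_sym.
Qed.

(** The inverse of the kernel matrix in the unit ball is a generalised one; on
    the range of the matrix it undoes the product by the matrix. *)
Lemma unit_ball_range f : (0 < n)%N -> unit_ball K H x f -> exists b,
  eval_vec f x = kernel_mx K x *m b /\ (b^T *m kernel_mx K x *m b) 0 0 <= n%:R.
Proof.
move=> n0 [Hf fK]; have [b fE] := eval_vec_range Hf; exists b; split=> //.
move: fK; rewrite fE trmx_mul kernel_mx_sym.
have -> : b^T *m kernel_mx K x *m pinvmx (kernel_mx K x) *m (kernel_mx K x *m b) =
    b^T *m kernel_mx K x *m b.
  by rewrite mulmxA mulmxKpV ?submxMl.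
by rewrite ler_pdivrMl ?ltr0n // mulr1.
Qed.

End Rkhs.

Section Expansion.
Context {d : measure_display} {X : measurableType d} {R : realType}.
Variables (K : X -> X -> R) (mu : nat -> R) (phi : nat -> X -> R).
Hypothesis mu0 : forall i, 0 <= mu i.
Hypothesis KE : forall x x',
  \sum_(i < N) mu i * phi i x * phi i x' @[N --> \oo] --> K x x'.
Variables (n : nat) (x : 'I_n -> X) (k : nat).

Let Phi : 'M[R]_(n, k) := \matrix_(i, j) phi j (x i).
Let B : 'M[R]_(k, n) := \matrix_(j, i) (n%:R^-1 * mu j * phi j (x i)).
Let K2 := kernel_mx K x - Phi *m B.

Lemma quadform_sum (M : 'M[R]_n) (v : 'cV[R]_n) :
  (v^T *m M *m v) 0 0 = \sum_i \sum_j v i 0 * v j 0 * M i j.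
Proof.
rewrite -mulmxA mxE; apply: eq_bigr => i _; rewrite !mxE mulr_sumr.
by apply: eq_bigr => j _; ring.
Qed.

Lemma cvg_sumr (I : Type) (r : seq I) (u : I -> nat -> R) (l : I -> R) :
  (forall i, u i N @[N --> \oo] --> l i) ->
  \sum_(i <- r) u i N @[N --> \oo] --> \sum_(i <- r) l i.
Proof.
move=> ul; elim: r => [|i r IHr].
  under eq_cvg do rewrite big_nil; rewrite big_nil; exact: cvg_cst.
under eq_cvg do rewrite big_cons; rewrite big_cons; exact: cvgD.
Qed.

Let features N (v : 'cV[R]_n) : R :=
  n%:R^-1 * \sum_(l < N) mu l * (\sum_i v i 0 * phi l (x i)) ^+ 2.

Lemma features_quadform N (v : 'cV[R]_n) : features N v =
  \sum_i \sum_j v i 0 * v j 0 *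
    (n%:R^-1 * \sum_(l < N) mu l * phi l (x i) * phi l (x j)).
Proof.
transitivity (n%:R^-1 * \sum_(l < N) \sum_i \sum_j
    v i 0 * v j 0 * (mu l * phi l (x i) * phi l (x j))).
  congr (_ * _); apply: eq_bigr => l _; rewrite expr2 big_distrlr mulr_sumr /=.
  apply: eq_bigr => i _; rewrite mulr_sumr; apply: eq_bigr => j _; ring.
rewrite exchange_big mulr_sumr; apply: eq_bigr => i _ /=.
rewrite exchange_big mulr_sumr; apply: eq_bigr => j _ /=.
by rewrite mulrCA -mulr_sumr.
Qed.

Lemma cvg_features (v : 'cV[R]_n) :
  features N v @[N --> \oo] --> (v^T *m kernel_mx K x *m v) 0 0.
Proof.
rewrite quadform_sum; under eq_cvg do rewrite features_quadform.
apply: cvg_sumr => i; apply: cvg_sumr => j.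
by apply: cvgM; [exact: cvg_cst|rewrite mxE; apply: cvgM; [exact: cvg_cst|exact: KE]].
Qed.

Lemma head_quadform (v : 'cV[R]_n) :
  (v^T *m (Phi *m B) *m v) 0 0 = features k v.
Proof.
rewrite features_quadform quadform_sum; apply: eq_bigr => i _.
apply: eq_bigr => j _; congr (_ * _); rewrite mxE mulr_sumr.
by apply: eq_bigr => l _; rewrite !mxE; ring.
Qed.

Lemma features_le (N : nat) (v : 'cV[R]_n) : (k <= N)%N ->
  features k v <= features N v <= features k v + n%:R^-1 *
    \sum_(k <= l < N) mu l * (\sum_i v i 0 * phi l (x i)) ^+ 2.
Proof.
move=> kN; rewrite /features -!(big_mkord xpredT
  (fun l => mu l * (\sum_i v i 0 * phi l (x i)) ^+ 2)).
rewrite (@big_cat_nat _ _ _ k 0%N N) //= mulrDr lexx andbT lerDl.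
rewrite mulr_ge0 ?invr_ge0 // sumr_ge0 // => l _.
by rewrite mulr_ge0 ?sqr_ge0.
Qed.

(** The quadratic form of the remainder is the limit of nonnegative sums over
    the eigenfunctions of index at least k. *)
Lemma kernel_mx_tail_psd : psd K2.
Proof.
move=> v; rewrite /K2 mulmxBr mulmxBl mxE [X in _ + X]mxE head_quadform subr_ge0.
apply: (@cvgr_to_ge _ _ _ _ (features ^~ v) _ _ (@cvg_features v)); near=> N.
have kN : (k <= N)%N by near: N; exact: nbhs_infty_ge.
by have /andP[] := features_le v kN.
Unshelve. all: by end_near. Qed.

(** The diagonal of the remainder is bounded by the tail of the eigenvalues,
    uniformly over the design, because the eigenfunctions are bounded. *)
Lemma kernel_mx_tail_trace (M T : R) : (0 < n)%N ->
  (forall i y, `|phi i y| <= M) ->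
  (forall N, \sum_(k <= l < N) mu l <= T) ->
  \tr K2 <= M ^+ 2 * T.
Proof.
move=> n0 phiM muT.
have entry i : K2 i i <= n%:R^-1 * (M ^+ 2 * T).
  rewrite -quadform_delta /K2 mulmxBr mulmxBl mxE [X in _ + X]mxE head_quadform lerBlDl.
  apply: (@cvgr_to_le _ _ _ _ (features ^~ _) _ _ (@cvg_features _)); near=> N.
  have kN : (k <= N)%N by near: N; exact: nbhs_infty_ge.
  have /andP[_] := features_le (delta_mx i 0) kN.
  move=> /le_trans; apply; rewrite lerD2l ler_wpM2l ?invr_ge0 //.
  apply: (@le_trans _ _ (\sum_(k <= l < N) M ^+ 2 * mu l)).
    apply: ler_sum => l _; rewrite mulrC ler_wpM2r //.
    rewrite (bigD1 i) //= big1 => [|j ji]; last by rewrite mxE (negbTE ji) mul0r.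
    rewrite !mxE !eqxx mul1r addr0 -[leLHS]real_normK ?num_real //.
    by rewrite lerXn2r ?nnegrE ?(le_trans (normr_ge0 _) (phiM l (x i))).
  by rewrite -mulr_sumr ler_wpM2l ?sqr_ge0.
apply: le_trans (ler_sum _ (fun i _ => entry i)) _.
by rewrite sumr_const card_ord -[leLHS]mulr_natl mulVKf // pnatr_eq0 -lt0n.
Unshelve. all: by end_near. Qed.

Lemma kernel_mx_split : kernel_mx K x = Phi *m B + K2.
Proof. by rewrite /K2 addrC subrK. Qed.

End Expansion.

(** * Rates *)
Section Rates.
Context {R : realType}.
Implicit Types (c : R) (m n : nat).

Lemma ln_nat_ge (A : R) : \forall n \near \oo, A <= ln (n%:R : R).
Proof.
near=> n; have An : expR A <= n%:R.
  by near: n; exact: nbhs_infty_ger.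
by rewrite -(expRK A) ler_ln ?posrE ?expR_gt0 // (lt_le_trans (expR_gt0 A)).
Unshelve. all: by end_near. Qed.

Lemma loglog_ge (A : R) : \forall n \near \oo, A <= loglog n.
Proof.
near=> n; have An : expR A <= ln (n%:R : R) by near: n; exact: ln_nat_ge.
by rewrite /loglog -(expRK A) ler_ln ?posrE ?expR_gt0 // (lt_le_trans (expR_gt0 A)).
Unshelve. all: by end_near. Qed.

(** The projection dimension q balances everything: the ridge parameter is
    c / q^(2m), and the squared separation rate r / n satisfies n lam = c r and
    r^2 = q log log n. *)
Lemma rates_balance c m n : (0 < n)%N -> 0 < loglog n :> R ->
  let q : R := s_lower m n in let r : R := n%:R * delta_rate m n ^+ 2 in
  [/\ 0 < q, 0 < r, lambda_seq c m n = c / q ^+ (2 * m),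
      n%:R * lambda_seq c m n = c * r & r ^+ 2 = q * loglog n].
Proof.
move=> n0 L0 q r; have N0 : (0 : R) < n%:R by rewrite ltr0n.
have p0 : (4 * m + 1)%N%:R != 0 :> R by rewrite pnatr_eq0 addn1.
have pE : (4 * m + 1)%N%:R = 4 * m%:R + 1 :> R by rewrite natrD natrM.
have powE (a x : R) : 0 < a -> a `^ x = expR (x * ln a).
  by move=> a0; rewrite /powR gt_eqF.
set l1 := ln (n%:R : R); set l2 := ln (loglog n : R).
have NE : n%:R = expR l1 by rewrite lnK // posrE.
have LE : loglog n = expR l2 by rewrite lnK // posrE.
have qE : q = expR ((2 * l1 - l2) / (4 * m + 1)%N%:R).
  by rewrite /q /s_lower !powE // -/l1 -/l2 -expRD; congr expR; field.
have dE : delta_rate m n = expR ((- (2 * m%:R) * l1 + m%:R * l2) / (4 * m + 1)%N%:R).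
  by rewrite /delta_rate !powE // -/l1 -/l2 -expRD natrM; congr expR; field.
have rE : r = expR ((l1 + 2 * m%:R * l2) / (4 * m + 1)%N%:R).
  rewrite /r dE NE -expRM_natl -expRD; congr expR.
  by rewrite pE; field; rewrite -pE.
have lE : lambda_seq c m n =
    c * expR ((- (4 * m%:R) * l1 + 2 * m%:R * l2) / (4 * m + 1)%N%:R).
  by rewrite /lambda_seq !powE // -/l1 -/l2 -mulrA -expRD !natrM; congr (_ * expR _); field.
split.
- by rewrite qE expR_gt0.
- by rewrite rE expR_gt0.
- rewrite lE qE -expRM_natl -expRN natrM; congr (_ * expR _); field.
  by rewrite -?pE.
- rewrite lE NE mulrCA -expRD rE; congr (_ * expR _).
  by rewrite pE; field; rewrite -pE.
- rewrite rE qE LE -expRM_natl -expRD; congr expR.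
  by rewrite pE; field; rewrite -pE.
Qed.

(** The logarithmic factor in q is absorbed because log log n <= log n. *)
Lemma s_lower_ge m (A : R) : \forall n \near \oo, A <= s_lower m n.
Proof.
near=> n.
have p0 : (0 : R) < (4 * m + 1)%N%:R by rewrite ltr0n addn1.
have l1A : `|A| * (4 * m + 1)%N%:R <= ln (n%:R : R) by near: n; exact: ln_nat_ge.
have L0 : (1 : R) <= loglog n by near: n; exact: loglog_ge.
have l10 : (1 : R) <= ln n%:R by near: n; exact: ln_nat_ge.
have n1 : (1 : R) < n%:R by rewrite ltr1n; near: n; exact: nbhs_infty_gt.
have powE (a x : R) : 0 < a -> a `^ x = expR (x * ln a).
  by move=> a0; rewrite /powR gt_eqF.
rewrite /s_lower !powE ?(lt_le_trans ltr01) ?(ltW n1) // -expRD.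
set l1 := ln (n%:R : R) in l1A l10 *; set l2 := ln (loglog n : R).
have l2l1 : l2 <= l1.
  have sub (y : R) : 1 <= y -> ln y <= y.
    by move=> y1; rewrite -ler_expR lnK ?posrE ?(lt_le_trans ltr01) // (le_trans _ (expR_ge1Dx y)) // lerDr.
  by apply: le_trans (sub _ L0) _; exact: sub.
apply: le_trans (ler_norm A) _.
apply: (@le_trans _ _ (l1 / (4 * m + 1)%N%:R)); first by rewrite ler_pdivlMr.
apply: le_trans (_ : _ <= 1 + _) (expR_ge1Dx _).
apply: (@le_trans _ _ (2 / (4 * m + 1)%N%:R * l1 + - (1 / (4 * m + 1)%N%:R) * l2)).
  rewrite mulNr mulrAC [_ * l2]mulrAC -mulrBl mul1r ler_pM2r ?invr_gt0 //.
  lra.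
by rewrite lerDr.
Unshelve. all: by end_near. Qed.

(** Both terms vanish since log log n tends to infinity, and so does
    r = sqrt (q log log n). *)
Lemma failure_rate_small m (C1 M0 e : R) :
  0 < C1 -> 0 < M0 -> 0 < e -> \forall n \near \oo,
  8 * C1 / (M0 ^+ 2 * loglog n) + 16 / (M0 * (n%:R * delta_rate m n ^+ 2)) <= e.
Proof.
move=> C10 M00 e0; near=> n.
have n0 : (0 < n)%N by near: n; exact: nbhs_infty_gt.
have L1 : (1 : R) <= loglog n by near: n; exact: loglog_ge.
have LA : 16 * C1 / (M0 ^+ 2 * e) <= loglog n by near: n; exact: loglog_ge.
have qA : (32 / (M0 * e)) ^+ 2 <= s_lower m n by near: n; exact: s_lower_ge.
have L0 : (0 : R) < loglog n by apply: lt_le_trans L1.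
have [q0 r0 _ _ rq] := rates_balance 1 m n0 L0.
set r := n%:R * _ in r0 rq *; set L := loglog n in L1 LA L0 rq *; clearbody r.
have rA : 32 / (M0 * e) <= r.
  rewrite -(@ler_pXn2r _ 2) ?nnegrE ?(ltW r0) ?divr_ge0 ?mulr_ge0 ?(ltW M00) ?(ltW e0) //.
  by rewrite rq (le_trans qA) // ler_peMr // ltW.
have h1 : 8 * C1 / (M0 ^+ 2 * L) <= e / 2.
  rewrite ler_pdivrMr ?mulr_gt0 ?exprn_gt0 //.
  move: LA; rewrite ler_pdivrMr ?mulr_gt0 ?exprn_gt0 //; lra.
have h2 : 16 / (M0 * r) <= e / 2.
  rewrite ler_pdivrMr ?mulr_gt0 //.
  move: rA; rewrite ler_pdivrMr ?mulr_gt0 //; lra.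
by apply: le_trans (lerD h1 h2) _; rewrite -splitr.
Unshelve. all: by end_near. Qed.

End Rates.

(** * Threshold and effective dimension *)
Section Threshold.
Context {R : realType}.

(** B_n is at most of the order of the square root of 2 log m_n, which is of the
    order of log log n as m_n is a power of log n. *)
Lemma threshold_le (mn : nat -> nat) (d0 : R) (B : nat -> R) (ca : R) (k : nat) :
  asymp (fun n => (mn n)%:R : R) (fun n => ln n%:R `^ d0) ->
  0 < d0 < 2^-1 ->
  (forall n, (2 <= mn n)%N ->
     0 < B n /\ 2 * pi * B n ^+ 2 * expR (B n ^+ 2) = (mn n)%:R ^+ 2) ->
  exists A : R, 0 < A /\ \forall n \near \oo,
    [/\ (k <= mn n)%N, 0 < B n & B n + ca / B n <= A * Num.sqrt (loglog n)].
Proof.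
move=> [a [b [a0 b0 ab]]] /andP[d00 d02] hB.
exists (2 + `|ca|); split; first by rewrite ltr_wpDr.
(* The last term makes m_n exceed 2 pi e, the value of 2 pi b^2 exp (b^2) at
   b = 1, and hence forces B_n >= 1. *)
pose K := maxn (maxn 2 k) (Num.truncn (2 * pi * expR 1 : R)).+1.
near=> n.
have L1 : (1 : R) <= loglog n by near: n; exact: loglog_ge.
have Lb : ln b <= loglog n by near: n; exact: loglog_ge.
have LK : K%:R / (a * d0) <= loglog n by near: n; exact: loglog_ge.
have l1 : (1 : R) <= ln n%:R by near: n; exact: ln_nat_ge.
have /andP[amn bmn] : a * ln (n%:R : R) `^ d0 <= (mn n)%:R <= b * ln n%:R `^ d0.
  by near: n.
have powE : ln (n%:R : R) `^ d0 = expR (d0 * loglog n).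
  by rewrite /powR gt_eqF // (lt_le_trans ltr01).
have Kmn : (K <= mn n)%N.
  rewrite -(ler_nat R); apply: le_trans amn.
  apply: (@le_trans _ _ (a * (d0 * loglog n))).
    by move: LK; rewrite ler_pdivrMr ?mulr_gt0 //; lra.
  by rewrite powE ler_pM2l // (le_trans _ (expR_ge1Dx _)) // lerDr.
have k2 : (2 <= mn n)%N by apply: leq_trans Kmn; rewrite !leq_max leqnn.
have kk : (k <= mn n)%N by apply: leq_trans Kmn; rewrite !leq_max leqnn orbT.
have [B0 BE] := hB n k2.
have mn1 : (1 : R) <= (mn n)%:R by rewrite ler1n (leq_trans _ k2).
have B1 : 1 <= B n.
  rewrite leNgt; apply/negP => B1.
  have : 2 * pi * expR 1 < (mn n)%:R ^+ 2 :> R.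
    apply: (@lt_le_trans _ _ (mn n)%:R); last by rewrite ler_eXnr.
    apply: lt_le_trans (truncnS_gt _) _; rewrite ler_nat.
    by apply: leq_trans Kmn; rewrite !leq_max leqnn !orbT.
  rewrite -BE ltNge => /negP; apply; rewrite -mulrA ler_pM2l ?mulr_gt0 ?pi_gt0 //.
  have B21 : B n ^+ 2 <= 1 by rewrite exprn_ile1 ?ltW.
  rewrite -[leRHS]mul1r; apply: ler_pM; rewrite ?sqr_ge0 ?expR_ge0 //.
  by rewrite ler_expR.
have B2 : B n ^+ 2 <= 2 * ln ((mn n)%:R : R).
  rewrite mulr_natl -lnXn ?(lt_le_trans ltr01) // -ler_expR lnK; last first.
    by rewrite posrE exprn_gt0 // (lt_le_trans ltr01).
  rewrite -BE ler_peMl ?expR_ge0 //.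
  have pi2 := pi_ge2 R.
  have : 1 <= B n ^+ 2 by rewrite exprn_ege1.
  nra.
have lnmn : ln ((mn n)%:R : R) <= ln b + d0 * loglog n.
  rewrite -ler_expR lnK ?posrE ?(lt_le_trans ltr01) // expRD lnK ?posrE //.
  by rewrite -powE.
have L0 : (0 : R) <= loglog n by apply: le_trans L1.
have Bs : B n <= 2 * Num.sqrt (loglog n).
  rewrite -(@ler_pXn2r _ 2) ?nnegrE ?mulr_ge0 ?sqrtr_ge0 ?(ltW B0) //.
  rewrite exprMn sqr_sqrtr //; nra.
have s1 : 1 <= Num.sqrt (loglog n : R) by rewrite -sqrtr1 ler_sqrt.
split=> //; rewrite mulrDl; apply: lerD => //.
apply: (@le_trans _ _ `|ca|).
  rewrite ler_pdivrMr //; apply: le_trans (ler_norm _) _.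
  by rewrite ler_peMr.
by rewrite ler_peMr.
Unshelve. all: by end_near. Qed.

End Threshold.

Section Eigenvalues.
Context {R : realType}.
Variables (m : nat) (mu : nat -> R).
Hypotheses (m2 : (2 <= m)%N) (mu_dec : poly_decay m mu).
Hypothesis mu_nonincr : forall i, mu i.+1 <= mu i.

Lemma mu_antitone i j : (i <= j)%N -> mu j <= mu i.
Proof. by move: i j; apply/nonincreasing_seqP. Qed.

Lemma mu_gt0 i : 0 < mu i.
Proof.
have [a [b [a0 b0 [N _ ab]]]] := mu_dec.
apply: lt_le_trans (mu_antitone (leq_addr N i)).
have /= := ab (i + N)%N (leq_addl i N) => /andP[+ _].
by apply: lt_le_trans; rewrite mulr_gt0 // invr_gt0 exprn_gt0 ?ltr0n.
Qed.

(** The shift k.+1 appears because eigenvalues are indexed from 0. *)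
Lemma mu_le_decay : exists b : R, 0 < b /\
  \forall k \near \oo, forall q : R, 0 < q -> q <= k.+1%:R ->
    mu k <= b / q ^+ (2 * m).
Proof.
have [a [b [a0 b0 ab]]] := mu_dec; exists b; split=> //.
near=> k => q q0 qk.
have /andP[_ /le_trans] : a * k.+1%:R ^- (2 * m) <= mu k <= b * k.+1%:R ^- (2 * m).
  by near: k.
apply; rewrite ler_pM2l // lef_pV2 ?posrE ?exprn_gt0 ?ltr0n //.
by rewrite lerXn2r ?nnegrE ?(ltW q0).
Unshelve. all: by end_near. Qed.

Lemma lambda_seq_gt0 (c : R) n : 0 < c -> (0 < n)%N -> 0 < loglog n :> R ->
  0 < lambda_seq c m n.
Proof. by move=> c0 n0 L0; rewrite /lambda_seq !mulr_gt0 ?powR_gt0 ?ltr0n. Qed.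

Lemma s_cutoff_gt (lam : R) j : 0 < lam -> lam < mu j -> (j < s_cutoff mu lam)%N.
Proof.
move=> lam0 lamj.
have ex : exists k, mu k <= lam.
  have [b [b0 dec]] := mu_le_decay.
  suff : \forall k \near \oo, mu k <= lam by move=> [N _ p]; exists N; apply: p => /=.
  near=> k; have b_lam : b / lam <= k.+1%:R.
    apply: le_trans (_ : k%:R <= _); last by rewrite ler_nat.
    by near: k; exact: nbhs_infty_ger.
  have dk : forall q : R, 0 < q -> q <= k.+1%:R -> mu k <= b / q ^+ (2 * m) by near: k.
  apply: le_trans (dk k.+1%:R _ (lexx _)) _; first by rewrite ltr0n.
  rewrite ler_pdivrMr ?exprn_gt0 ?ltr0n // mulrC -ler_pdivrMr //.
  apply: le_trans b_lam _; rewrite ler_eXnr ?ler1n //.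
  by rewrite muln_gt0 /= (leq_trans _ m2).
have [k kP kmin] := ex_minnP ex.
have : s_cutoff mu lam \in [set k | mu k <= lam /\ forall j, (j < k)%N -> lam < mu j].
  rewrite inE; apply: xgetPex; exists k; split=> // i ik.
  by rewrite ltNge; apply/negP => /kmin; rewrite leqNgt ik.
rewrite inE => -[mus _]; rewrite ltnNge; apply/negP => /mu_antitone.
by rewrite leNgt (le_lt_trans mus).
Unshelve. all: by end_near. Qed.

(** For fixed j, the eigenvalue of index j is eventually above lam, which tends
    to 0. *)
Lemma s_cutoff_ge (c : R) (j : nat) : 0 < c ->
  \forall n \near \oo, (j <= s_cutoff mu (lambda_seq c m n))%N.
Proof.
move=> c0; near=> n.
have n0 : (0 < n)%N by near: n; exact: nbhs_infty_gt.
have L0 : (0 : R) < loglog n.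
  by apply: lt_le_trans ltr01 _; near: n; exact: loglog_ge.
have [q0 _ lamE _ _] := rates_balance c m n0 L0.
apply/ltnW/s_cutoff_gt; first exact: lambda_seq_gt0.
have q1 : (1 : R) <= s_lower m n by near: n; exact: s_lower_ge.
have qj : 1 + c / mu j <= s_lower m n by near: n; exact: s_lower_ge.
rewrite lamE ltr_pdivrMr ?exprn_gt0 // mulrC -ltr_pdivrMr ?mu_gt0 //.
apply: (@lt_le_trans _ _ (s_lower m n)).
  by apply: lt_le_trans qj; rewrite ltrDr.
by rewrite ler_eXnr // muln_gt0 /= (leq_trans _ m2).
Unshelve. all: by end_near. Qed.

(** With k = q + O(1) leading eigenfunctions, regularity bounds the tail of the
    eigenvalues by a multiple of k mu_k, which decays like q q^(-2m), the order
    of q lam. *)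
Lemma mxtrace_Delta4_rate d (X : measurableType d) (K : X -> X -> R)
    (phi : nat -> X -> R) (c : R) : 0 < c ->
  regular_expansion mu phi ->
  (forall x x', \sum_(i < N) mu i * phi i x * phi i x' @[N --> \oo] --> K x x') ->
  exists C : R, 0 < C /\ \forall n \near \oo, forall (x : 'I_n -> X) s
    (S : 'M[R]_(s, n)), (kernel_mx K x)^T = kernel_mx K x ->
    psd (kernel_mx K x) ->
    \tr (Delta (lambda_seq c m n) (kernel_mx K x) S ^+ 4) <= C * s_lower m n.
Proof.
move=> c0 [[M phiM] [T muT]] KE; have [b [b0 [Nd _ dec]]] := mu_le_decay.
have W0 : 0 <= M ^+ 2 * `|T| * b / (4 * c).
  apply: divr_ge0; last by rewrite mulr_ge0 // ltW.
  by apply: mulr_ge0 (ltW b0); rewrite mulr_ge0 ?sqr_ge0.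
exists (2 * (1 + M ^+ 2 * `|T| * b / (4 * c))); split.
  by rewrite mulr_gt0 // ltr_pwDl.
near=> n => x s S Ksym Kpsd.
have n0 : (0 < n)%N by near: n; exact: nbhs_infty_gt.
have L0 : (0 : R) < loglog n.
  by apply: lt_le_trans ltr01 _; near: n; exact: loglog_ge.
have [q0 _ lamE _ _] := rates_balance c m n0 L0.
have lam0 := lambda_seq_gt0 c0 n0 L0.
have q1 : (1 : R) <= s_lower m n by near: n; exact: s_lower_ge.
have qNd : (Nd%:R : R) <= s_lower m n by near: n; exact: s_lower_ge.
set q := s_lower m n in q0 q1 qNd lamE *; set lam := lambda_seq c m n in lamE lam0 *.
pose k := Num.truncn q.
have /andP[kq qk] : k%:R <= q < k.+1%:R by apply: truncn_itv; exact: ltW.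
have decq : mu k <= b / q ^+ (2 * m).
  apply: dec => //=; last exact: ltW.
  rewrite -ltnS -(ltr_nat R); exact: le_lt_trans qk.
have tail N : \sum_(k.+1 <= l < N) mu l <= `|T| * (k.+1%:R * mu k).
  rewrite -lee_fin -sumEFin; apply: le_trans (nneseries_lim_ge N _) _.
    by move=> l _ _; rewrite lee_fin ltW // mu_gt0.
  apply: le_trans (muT k) _; rewrite lee_fin ler_wpM2r ?ler_norm //.
  by rewrite mulr_ge0 // ltW // mu_gt0.
have mu0 l := ltW (mu_gt0 l).
apply: le_trans (mxtrace_Delta4_le_tail S Ksym Kpsd lam0
  (kernel_mx_split K mu phi x k.+1) (kernel_mx_tail_psd mu0 KE x k.+1)) _.
have tr := kernel_mx_tail_trace mu0 KE x n0 phiM tail.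
apply: (@le_trans _ _ (k.+1%:R + M ^+ 2 * (`|T| * (k.+1%:R * mu k)) / (4 * lam))).
  by rewrite lerD2l ler_wpM2r // invr_ge0 mulr_ge0 // ltW.
have mulam : mu k / lam <= b / c.
  rewrite ler_pdivrMr // lamE; apply: le_trans decq _.
  by rewrite mulrA divfK ?gt_eqF.
apply: (@le_trans _ _ (k.+1%:R * (1 + M ^+ 2 * `|T| * b / (4 * c)))).
  rewrite mulrDr mulr1 lerD2l.
  have -> : M ^+ 2 * (`|T| * (k.+1%:R * mu k)) / (4 * lam) =
      k.+1%:R * (M ^+ 2 * `|T| / 4) * (mu k / lam) by field; rewrite gt_eqF.
  have -> : k.+1%:R * (M ^+ 2 * `|T| * b / (4 * c)) =
      k.+1%:R * (M ^+ 2 * `|T| / 4) * (b / c) by field; rewrite gt_eqF.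
  apply: ler_wpM2l => //; rewrite mulr_ge0 // divr_ge0 //.
  by rewrite mulr_ge0 ?sqr_ge0.
rewrite [leRHS]mulrAC ler_wpM2r //.
  exact: addr_ge0.
by rewrite -natr1; lra.
Unshelve. all: by end_near. Qed.

End Eigenvalues.

(** * Events of (a, b)-type *)
Section TypeEvents.
Context {dO : measure_display} {Omega : measurableType dO} {R : realType}.
Variable P : probability Omega R.

Lemma expeRN_ge (a : \bar R) (a0 : R) : (a0%:E <= a)%E ->
  exists2 u : R, expeR (- a) = u%:E & 0 <= u <= expR (- a0).
Proof.
case: a => [r| |] //=; last by exists 0 => //; rewrite lexx expR_ge0.
by rewrite lee_fin => r0; exists (expR (- r)); rewrite ?expR_ge0 ?ler_expR ?lerN2.
Qed.

(** The probability of an event dominates the integral of its conditional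
    probability over the set where the latter is large. *)
Lemma of_type_ge (G : set (set Omega)) (E : set Omega) (a b : \bar R) (a0 b0 : R) :
  G `<=` measurable -> 0 <= a0 -> 0 <= b0 -> (a0%:E <= a)%E -> (b0%:E <= b)%E ->
  of_type P G E a b -> ((1 - expR (- a0) - expR (- b0))%:E <= P E)%E.
Proof.
move=> GM a00 b00 /expeRN_ge[u uE /andP[u0 ua]] /expeRN_ge[v vE /andP[v0 vb]] [mE [g [Gg intg]]].
rewrite uE vE -!EFinB => PD.
set D := [set w | _] in PD.
have GD : G D.
  rewrite (_ : D = g @^-1` [set` `[1 - u, +oo[]); first exact: Gg.
  by apply/seteqP; split=> w; rewrite /D /= lee_fin in_itv /= andbT.
have mD := GM _ GD.
have u1 : 0 <= 1 - u.
  by rewrite subr_ge0 (le_trans ua) // -expR0 ler_expR oppr_le0.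
have v1 : v <= 1 by rewrite (le_trans vb) // -expR0 ler_expR oppr_le0.
have mg : measurable_fun D (EFin \o g).
  apply/measurable_EFinP/measurable_funTS => _ B mB; rewrite setTI.
  by apply: GM; exact: Gg.
apply: (@le_trans _ _ (P (E `&` D))); last first.
  by apply: le_measure; rewrite ?inE //; exact: measurableI.
rewrite -intg //; apply: (@le_trans _ _ (\int[P]_(w in D) (1 - u)%:E)%E).
  rewrite integral_cst //; apply: (@le_trans _ _ ((1 - u)%:E * (1 - v)%:E)%E).
    rewrite -EFinM lee_fin.
    have := mulr_ge0 u0 v0; lra.
  by apply: lee_wpmul2l.
exact: ge0_le_integral.
Qed.

(** Events of (c1 s, c2 t)-type become almost sure as s and t grow. *)
Lemma of_type_cvg (G : nat -> set (set Omega)) (E : nat -> set Omega)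
    (c1 c2 : \bar R) (s t : nat -> nat) :
  (forall n, G n `<=` measurable) -> (0 < c1)%E -> (0 < c2)%E ->
  (\forall n \near \oo, of_type P (G n) (E n) (c1 * (s n)%:R%:E)%E (c2 * (t n)%:R%:E)%E) ->
  (forall A : R, \forall n \near \oo, A <= (s n)%:R) ->
  (forall A : R, \forall n \near \oo, A <= (t n)%:R) ->
  P (E n) @[n --> \oo] --> 1%E.
Proof.
move=> GM c10 c20 ty sy ty'.
have real_lb (c : \bar R) : (0 < c)%E -> exists2 r : R, 0 < r & (r%:E <= c)%E.
  case: c => [r| |] //; first by rewrite lte_fin => r0; exists r.
  by move=> _; exists 1; rewrite ?leey.
have [r1 r10 rc1] := real_lb _ c10; have [r2 r20 rc2] := real_lb _ c20.
have expN_le (r e : R) (k : nat) : 0 < r -> 0 < e -> (2 / e / r) <= k%:R ->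
    expR (- (r * k%:R)) <= e / 2.
  move=> r0 e0 k_ge; rewrite expRN -[e / 2]invrK invf_div lef_pV2 ?posrE ?expR_gt0 ?divr_gt0 //.
  apply: le_trans (expR_ge1Dx _); apply: ler_wpDl => //.
  by rewrite ler_pdivrMr // in k_ge; rewrite [r * _]mulrC.
apply/fine_cvgP; split.
  near=> n; rewrite fin_num_measure //.
  have [] : of_type P (G n) (E n) (c1 * (s n)%:R%:E)%E (c2 * (t n)%:R%:E)%E by near: n.
  by [].
apply/cvgrPdist_le => e e0; near=> n.
have ofn : of_type P (G n) (E n) (c1 * (s n)%:R%:E)%E (c2 * (t n)%:R%:E)%E by near: n.
have mE : measurable (E n) by case: ofn.
have sA : 2 / e / r1 <= (s n)%:R by near: n; exact: sy.
have tA : 2 / e / r2 <= (t n)%:R by near: n; exact: ty'.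
have le0 (r : R) (k : nat) : 0 < r -> 0 <= r * k%:R by move=> r0; rewrite mulr_ge0 ?(ltW r0).
have := of_type_ge (GM n) (le0 r1 (s n) r10) (le0 r2 (t n) r20) _ _ ofn.
rewrite !EFinM !lee_wpmul2r ?lee_fin // => /(_ isT isT).
rewrite -[P (E n)]fineK ?fin_num_measure // lee_fin => PE.
have P1 : fine (P (E n)) <= 1 by rewrite -lee_fin fineK ?fin_num_measure // probability_le1.
rewrite /= ger0_norm ?subr_ge0 // lerBlDl -lerBlDr.
apply: le_trans PE; have := expN_le r1 e (s n) r10 e0 sA.
have := expN_le r2 e (t n) r20 e0 tA; lra.
Unshelve. all: by end_near. Qed.

End TypeEvents.

(** * Detection on a satisfiable design *)
Section Detection.
Context {R : realType}.

(** For a fixed satisfiable design, the bias uses up a fixed multiple of r, so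
    that the signal captured by the smoother has squared norm at least M0 r. This
    dominates both the threshold A sqrt L times the standard deviation of the
    statistic without signal, which is of order sqrt (q L) = r, and the
    fluctuations of the statistic. *)
Lemma design_power n s (K : 'M[R]_n) (S : 'M[R]_(s, n))
    (lam c cs q L r C1 A M0 : R) (f b : 'cV[R]_n) :
  (0 < n)%N -> K^T = K -> psd K -> 0 < lam -> 0 < c -> 0 < cs ->
  0 < q -> 0 < L -> 0 < r -> 0 < C1 -> 0 <= A -> 0 < M0 ->
  satisfiable cs lam K S ->
  n%:R * lam = c * r -> r ^+ 2 = q * L ->
  \tr (Delta lam K S ^+ 4) <= C1 * q ->
  2 * (A * Num.sqrt (2 * C1)) <= M0 ->
  f = K *m b -> (b^T *m K *m b) 0 0 <= n%:R ->
  2 * (c * (2 + 6 * cs ^+ 2) + M0) * r <= (f^T *m f) 0 0 ->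
  ((1 - (8 * C1 / (M0 ^+ 2 * L) + 16 / (M0 * r)))%:E <=
   iid_prob std_normal n
     [set z | (A * Num.sqrt L <= stat_tau (Delta lam K S) (noisy f z))%R])%E.
Proof.
move=> n0 Ksym Kpsd lam0 c0 cs0 q0 L0 r0 C10 A0 M00 sat nlam rqL trD AM fE bK fr.
set D := Delta lam K S in trD *.
have Dsym : D^T = D by exact: Delta_sym.
have D1 : psd (1%:M - D ^+ 2).
  have -> : 1%:M - D ^+ 2 = (1%:M - D) + (D - D *m D).
    by rewrite addrA subrK expr2 mulmxE.
  by apply: psdD; [exact: psd_1_sub_Delta | exact: psd_Delta_sub_sqr].
pose F := (f^T *m D ^+ 2 *m f) 0 0; pose V := \tr (D ^+ 4).
have FE : F = ((D *m f)^T *m (D *m f)) 0 0.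
  by rewrite /F trmx_mul Dsym expr2 -mulmxE !mulmxA.
have bias : ((f - D *m f)^T *m (f - D *m f)) 0 0 <= c * (2 + 6 * cs ^+ 2) * r.
  rewrite fE; apply: le_trans (sketched_bias b Ksym Kpsd lam0 cs0 sat) _.
  have w0 : 0 <= lam * (2 + 6 * cs ^+ 2).
    by rewrite mulr_ge0 ?(ltW lam0) // addr_ge0 // mulr_ge0 // sqr_ge0.
  apply: le_trans (ler_wpM2l w0 bK) _.
  by rewrite mulrAC [lam * _]mulrC nlam mulrAC.
have M0F : M0 * r <= F.
  (* |u + g|^2 <= 2 |u|^2 + 2 |g|^2, for u = D f and g = f - D f. *)
  have half (u g : 'cV[R]_n) :
      ((u + g)^T *m (u + g)) 0 0 <= 2 * (u^T *m u) 0 0 + 2 * (g^T *m g) 0 0.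
    have := dotmx_ge0 (u + (- 1) *: g).
    by rewrite !dotmxD !(dotmxZl, dotmxZr); lra.
  have := half (D *m f) (f - D *m f); rewrite -FE addrC subrK.
  move: bias fr; set g := ((f - _)^T *m _) 0 0; lra.
have F0 : 0 < F by apply: lt_le_trans M0F; rewrite mulr_gt0.
have V0 : 0 <= V.
  rewrite /V (exprD _ 2 2); have -> : D ^+ 2 * D ^+ 2 = (D ^+ 2)^T *m D ^+ 2.
    by rewrite expr2 -mulmxE trmx_mul Dsym.
  apply: mxtrace_psd_ge0; exact: psd_gram.
have sq : Num.sqrt L * Num.sqrt q = r.
  by rewrite -sqrtrM ?(ltW L0) // mulrC -rqL sqrtr_sqr ger0_norm // ltW.
have thr : 2 * (A * Num.sqrt L * Num.sqrt (2 * V)) <= F.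
  apply: le_trans M0F; apply: (@le_trans _ _ (2 * (A * Num.sqrt (2 * C1)) * r)); last first.
    by rewrite ler_wpM2r // ltW.
  have -> : 2 * (A * Num.sqrt (2 * C1)) * r =
      2 * (A * Num.sqrt L * (Num.sqrt (2 * C1) * Num.sqrt q)) by rewrite -sq; ring.
  rewrite ler_pM2l //; apply: ler_wpM2l; first by rewrite mulr_ge0 ?sqrtr_ge0.
  rewrite -sqrtrM ?mulr_ge0 ?(ltW C10) // ler_sqrt ?mulr_ge0 ?(ltW C10) ?(ltW q0) //.
  by rewrite -mulrA ler_pM2l.
apply: le_trans (stat_tau_power n0 Dsym D1 F0 _ thr); last first.
  by rewrite mulr_ge0 ?sqrtr_ge0.
rewrite lee_fin lerD2l lerN2 -/F -/V mulrDl; apply: lerD.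
  rewrite ler_pdivrMr ?exprn_gt0 //.
  apply: (@le_trans _ _ (8 * C1 / (M0 ^+ 2 * L) * (M0 * r) ^+ 2)).
    have -> : 8 * C1 / (M0 ^+ 2 * L) * (M0 * r) ^+ 2 = 8 * (C1 * q).
      by rewrite exprMn rqL; field; rewrite !gt_eqF.
    by rewrite ler_pM2l.
  apply: ler_wpM2l.
    by apply: ltW; rewrite divr_gt0 ?mulr_gt0 ?exprn_gt0.
  by rewrite lerXn2r ?nnegrE ?(ltW F0) ?(mulr_ge0 (ltW M00) (ltW r0)).
rewrite expr2 invfM mulrA mulfK ?gt_eqF // ler_pM2l // lef_pV2 ?posrE ?mulr_gt0 //.
Qed.

Lemma measurable_stat_tau n (D : 'M[R]_n) (f : 'cV[R]_n) :
  measurable_fun setT (fun z : n.-tuple R => stat_tau D (noisy f z)).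
Proof.
rewrite /stat_tau /stat_T; apply: measurable_funM => //; apply: measurable_funB => //.
apply: measurable_funM => //; apply: measurable_funM => //.
under eq_fun do rewrite quadform_sum.
apply: measurable_sum => i; apply: measurable_sum => j.
have mN k : measurable_fun setT (fun z : n.-tuple R => (noisy f z) k 0).
  under eq_fun do rewrite mxE.
  by apply: measurable_funD => //; exact: measurable_tnth.
by apply: measurable_funM => //; exact: measurable_funM.
Qed.

Lemma measurable_stat_adaptive n (B : R) (mn : nat) (D : nat -> 'M[R]_n) (f : 'cV[R]_n) :
  measurable_fun setT (fun z : n.-tuple R =>
    stat_adaptive B mn (fun m => stat_tau (D m) (noisy f z))).
Proof.
apply: measurable_funM => //; apply: measurable_funB => //.
rewrite /stat_max; elim: (index_iota _ _) => [|m ms IH].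
  by under eq_fun do rewrite big_nil; exact: measurable_stat_tau.
under eq_fun do rewrite big_cons; apply: measurable_maxr => //.
exact: measurable_stat_tau.
Qed.

Lemma stat_adaptive_ge (B t ca : R) (mn m : nat) (tau : nat -> R) :
  0 < B -> (2 <= m <= mn)%N -> B + ca / B <= t -> t <= tau m ->
  ca <= stat_adaptive B mn tau.
Proof.
move=> B0 /andP[m2 mmn] Bt tm; rewrite /stat_adaptive.
have : tau m <= stat_max mn tau.
  by apply: le_bigmax_seq => //; rewrite mem_index_iota m2.
move=> tm'; rewrite -ler_pdivrMl // mulrC lerBrDl.
exact: le_trans Bt (le_trans tm tm').
Qed.

End Detection.

(** * Power of the adaptive test *)
Section DesignSigmaAlgebra.
Context {dO : measure_display} {Omega : measurableType dO} {R : realType}.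
Context {d : measure_display} {X : measurableType d}.
Variable P : probability Omega R.

Lemma preimage_RV_measurable d' (T : measurableType d') (Y : {RV P >-> T}) :
  preimage_set_system setT Y measurable `<=` measurable.
Proof. by move=> _ [B mB <-]; rewrite setTI; exact: measurable_funPTI. Qed.

Lemma g_sigma_preimage_RV_measurable n (x : 'I_n -> {RV P >-> X}) :
  g_sigma_preimage x `<=` measurable.
Proof.
apply: smallest_sub; first exact: sigma_algebra_measurable.
by rewrite -bigcup_seq => B [i _]; exact: preimage_RV_measurable.
Qed.

Lemma sigma_design_measurable n mn (x : 'I_n -> {RV P >-> X}) (s : nat -> nat)
    (S : forall m, 'I_(s m) -> 'I_n -> {RV P >-> R}) :
  sigma_design mn x S `<=` measurable.
Proof.
apply: smallest_sub; first exact: sigma_algebra_measurable.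
move=> B [[i _]|[m _ [i _ [j _]]]]; exact: preimage_RV_measurable.
Qed.

End DesignSigmaAlgebra.

Lemma response_noisy (R : realType) d (X : measurableType d) n (f : X -> R)
    (x : 'I_n -> X) (z : n.-tuple R) :
  response f x z = noisy (eval_vec f x) z.
Proof. by apply/colP => i; rewrite !mxE. Qed.

Lemma empirical_norm_ge (R : realType) d (X : measurableType d) n (f : X -> R)
    (x : 'I_n -> X) (C2 t : R) : (0 < n)%N -> 0 <= C2 -> 0 <= t ->
  Num.sqrt C2 * t <= empirical_norm f x ->
  C2 * (n%:R * t ^+ 2) <= ((eval_vec f x)^T *m eval_vec f x) 0 0.
Proof.
move=> n0 C20 t0; have N0 : (0 : R) < n%:R by rewrite ltr0n.
have S0 : 0 <= \sum_i f (x i) ^+ 2 by apply: sumr_ge0 => i _; exact: sqr_ge0.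
rewrite -(@ler_pXn2r _ 2) ?nnegrE ?mulr_ge0 ?sqrtr_ge0 //.
rewrite exprMn !sqr_sqrtr ?mulr_ge0 ?invr_ge0 // => h.
rewrite dotmx_sum (eq_bigr (fun i => f (x i) ^+ 2)) => [|i _]; last by rewrite mxE.
by rewrite mulrCA -ler_pdivlMl.
Qed.

Theorem theorem5p2
  (R : realType) (dim : nat) (hdim : (1 <= dim)%N)
  (calX : set (dim.-tuple R)) (x0 : calX)
  (PX : probability (input_space x0) R)
  (* kernels K_m, m >= 2 *)
  (K : nat -> input_space x0 -> input_space x0 -> R)
  (H : nat -> set (input_space x0 -> R))
  (ip : nat -> (input_space x0 -> R) -> (input_space x0 -> R) -> R)
  (mu : nat -> nat -> R) (phi : nat -> nat -> input_space x0 -> R)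
  (hK : forall m, (2 <= m)%N ->
     is_kernel_of_order PX m (K m) (H m) (ip m) (mu m) (phi m))
  (mstar : nat) (hmstar : (2 <= mstar)%N)
  (c : R) (hc : 0 < c)
  (d0 : R) (hd0 : 0 < d0 < 2^-1)
  (alpha : R) (halpha : 0 < alpha < 1)
  (mn : nat -> nat)
  (hmn : asymp (fun n => (mn n)%:R : R) (fun n => ln n%:R `^ d0))
  (B : nat -> R)
  (hB : forall n, (2 <= mn n)%N ->
     0 < B n /\ 2 * pi * B n ^+ 2 * expR (B n ^+ 2) = (mn n)%:R ^+ 2) :
  (* "for a sufficiently large constant d" *)
  exists dmin : R, 0 < dmin /\ forall d : R, dmin <= d ->
  forall (dO : measure_display) (Omega : measurableType dO)
    (P : probability Omega R)
    (x : forall n, 'I_n -> {RV P >-> input_space x0})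
    (eps : forall n, 'I_n -> {RV P >-> R})
    (s : nat -> nat -> nat)
    (S : forall n m, 'I_(s n m) -> 'I_n -> {RV P >-> R})
    (kappa : forall n, Omega -> probability (n.-tuple R) R),
  (forall n, iid_with_law PX (@x n)) ->
  (forall n, iid_with_law (normal_prob 0 1 : set R -> \bar R) (@eps n)) ->
  (forall n, independent_sigma P (g_sigma_preimage (@eps n))
               (sigma_design (mn n) (@x n) (@S n))) ->
  (forall n m, (3 <= n)%N -> (2 <= m <= mn n)%N ->
     d * s_lower m n <= (s n m)%:R) ->
  (forall m, (2 <= m)%N ->
     sketch_satisfiability m mn (lambda_seq c m) (K m) (mu m) x (fun n => @S n m)) ->
  (* conditional law of the noise given the x_i and the projection matrices *)
  (forall n, is_cond_distribution P (sigma_design (mn n) (@x n) (@S n))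
               (noise_vec (@eps n)) (@kappa n)) ->
  forall e : R, 0 < e ->
  exists (C : R) (N : nat), [/\ 0 < C, (0 < N)%N &
    with_prob_approaching_1 P (fun n => [set w | (N <= n)%N ->
      let xw := sample (@x n) w in
      ((1 - e)%:E <= ereal_inf
        [set kappa n w
           [set z : n.-tuple R |
             (- ln (- ln (1 - alpha)) <=
             stat_adaptive (B n) (mn n) (fun m =>
               stat_tau (Delta (lambda_seq c m n) (kernel_mx (K m) xw)
                           (random_mx (@S n m) w))
                 (response f xw z)))%R]
        | f in [set f | unit_ball (K mstar) (H mstar) xw f /\
                        (C * delta_rate mstar n <= empirical_norm f xw)%R]])%E])].

Proof.
have [KH _ Kexp Kdec Kreg] := hK mstar hmstar.
set ca := - ln (- ln (1 - alpha)).
(* Any multiple of the lower bound on s_m makes the projection dimension tend to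
   infinity; 1 is a convenient choice. *)
exists 1; split=> // d d1 dO Omega P x eps s S kappa hx heps hind hs hsat hkappa e e0.
have mu_ni := expansion_nonincr Kexp.
have [cs [c1 [c2 [cs0 c10 c20 hty]]]] := hsat mstar hmstar.
have [A [A0 thr]] := threshold_le ca mstar hmn hd0 hB.
have [C1 [C10 trD]] :=
  mxtrace_Delta4_rate Kdec mu_ni hc Kreg (expansion_kernel Kexp).
(* M0 r is the signal that must survive the bias: the first term beats the
   threshold, the summand 1 keeps it positive. *)
pose M0 := 2 * (A * Num.sqrt (2 * C1)) + 1.
have M00 : 0 < M0 by rewrite ltr_wpDl // !mulr_ge0 ?sqrtr_ge0 ?(ltW A0).
pose C2 := 2 * (c * (2 + 6 * cs ^+ 2) + M0).
have C20 : 0 < C2.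
  rewrite mulr_gt0 // addr_gt0 // mulr_gt0 // addr_gt0 // mulr_gt0 // exprn_gt0 //.
have : \forall n \near \oo, [/\ (3 <= n)%N, (0 : R) < loglog n,
    [/\ (mstar <= mn n)%N, 0 < B n & B n + ca / B n <= A * Num.sqrt (loglog n)],
    8 * C1 / (M0 ^+ 2 * loglog n) + 16 / (M0 * (n%:R * delta_rate mstar n ^+ 2)) <= e &
    forall (z : 'I_n -> input_space x0) k (T : 'M[R]_(k, n)),
      (kernel_mx (K mstar) z)^T = kernel_mx (K mstar) z ->
      psd (kernel_mx (K mstar) z) ->
      \tr (Delta (lambda_seq c mstar n) (kernel_mx (K mstar) z) T ^+ 4) <=
        C1 * s_lower mstar n].
  near=> n; split.
  - by near: n; exact: nbhs_infty_ge.
  - by apply: lt_le_trans ltr01 _; near: n; exact: loglog_ge.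
  - by near: n.
  - by near: n; exact: failure_rate_small.
  - by near: n.
move=> [N _ good].
pose E n := [set w | satisfiable cs (lambda_seq c mstar n)
  (kernel_mx (K mstar) (sample (@x n) w)) (random_mx (@S n mstar) w)].
have tyE n : (N <= n)%N -> of_type P (g_sigma_preimage (@x n)) (E n)
    (c1 * (s n mstar)%:R%:E)%E
    (c2 * (s_cutoff (mu mstar) (lambda_seq c mstar n))%:R%:E)%E.
  by move=> /good[n3 _ [mmn _ _] _ _]; apply: hty => //; rewrite hmstar.
have PE : P (E n) @[n --> \oo] --> 1%E.
  apply: (@of_type_cvg _ _ _ P (fun n => g_sigma_preimage (@x n)) E c1 c2
    (fun n => s n mstar) (fun n => s_cutoff (mu mstar) (lambda_seq c mstar n))) => //.
  - by move=> n; exact: g_sigma_preimage_RV_measurable.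
  - by exists N => // n /= /tyE; exact.
  - move=> a; near=> n; have Nn : (N <= n)%N by near: n; exact: nbhs_infty_ge.
    have [n3 L0 [mmn _ _] _ _] := good n Nn.
    have [q0 _ _ _ _] := rates_balance c mstar (leq_trans (ltn0Sn 2) n3) L0.
    apply: (@le_trans _ _ (s_lower mstar n)); first by near: n; exact: s_lower_ge.
    apply: le_trans (hs n mstar n3 _); first by rewrite ler_peMl // ltW.
    by rewrite hmstar.
  - move=> a; have := s_cutoff_ge hmstar Kdec mu_ni (Num.truncn a).+1 hc.
    apply: filterS => n; rewrite -(ler_nat R); apply: le_trans.
    by apply: ltW; exact: truncnS_gt.
have negZ n : P.-negligible [set w | ~ forall U, measurable U ->
    kappa n w U = iid_prob std_normal n U].
  by apply: cond_distribution_iid (heps n) (hind n) (hkappa n); exact: sigma_design_measurable.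
pose Z n := sval (cid (negZ n)).
have ZP n : [/\ measurable (Z n), P (Z n) = 0%E &
    [set w | ~ forall U, measurable U ->
       kappa n w U = iid_prob std_normal n U] `<=` Z n] := svalP (cid (negZ n)).
exists (Num.sqrt C2), (maxn N 1); split; [by rewrite sqrtr_gt0|by rewrite leq_max orbT|].
(* E n: the sketch is satisfiable; Z n: a null set outside of which the
   conditional law of the noise is normal. For n < N the bound is claimed of no
   design, hence the whole space. *)
exists (fun n => if (N <= n)%N then E n `\` Z n else setT); split.
- move=> n; case: ifP => // Nn; have [mZ _ _] := ZP n.
  by apply: measurableD => //; case: (tyE n Nn).
- move=> n w; case: ifP => [Nn [Ew Zw]|nN _] /=; last first.
    by rewrite geq_max => /andP[]; rewrite nN.
  move=> _; apply: le_ereal_inf_tmp => _ [f [fball fnorm] <-].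
  have kE : forall U, measurable U -> kappa n w U = iid_prob std_normal n U.
    by apply: contrapT => bad; apply: Zw; have [_ _] := ZP n; apply.
  have [n3 L0 [mmn B0 Bthr] small trn] := good n Nn.
  have n0 : (0 < n)%N := leq_trans (ltn0Sn 2) n3.
  have [q0 r0 lamE nlam rq] := rates_balance c mstar n0 L0.
  have Ksym := kernel_mx_sym KH (sample (@x n) w).
  have Kpsd := kernel_mx_psd KH (sample (@x n) w).
  have lam0 := @lambda_seq_gt0 R mstar c n hc n0 L0.
  have [b [fE bK]] := unit_ball_range KH n0 fball.
  set D := fun m => Delta (lambda_seq c m n) (kernel_mx (K m) (sample (@x n) w))
    (random_mx (@S n m) w).
  pose fv := @eval_vec _ (input_space x0) R n f (sample (@x n) w).
  rewrite (_ : [set z | _] = [set z : n.-tuple R |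
      (ca <= stat_adaptive (B n) (mn n) (fun m => stat_tau (D m) (noisy fv z)))%R]);
    last first.
    apply: eq_set => z; congr (is_true (_ <= stat_adaptive _ _ _)).
    by apply/funext => m; rewrite response_noisy.
  have mset (g : n.-tuple R -> R) (a : R) : measurable_fun setT g ->
      measurable [set z | a <= g z].
    move=> mg; rewrite (_ : [set z | _] = g @^-1` [set` `[a, +oo[]).
      by rewrite -[X in measurable X]setTI; exact: mg.
    by apply/seteqP; split=> z; rewrite /= in_itv /= andbT.
  have mtarget := mset _ ca (measurable_stat_adaptive (B n) (mn n) D fv).
  rewrite kE //.
  have signal := empirical_norm_ge n0 (ltW C20) _ fnorm.
  have AM : 2 * (A * Num.sqrt (2 * C1)) <= M0 by rewrite /M0 lerDl.
  have pw := design_power n0 Ksym Kpsd lam0 hc cs0 q0 L0 r0 C10 (ltW A0) M00 Ew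
    nlam rq (trn _ _ _ Ksym Kpsd) AM fE bK.
  apply: le_trans (_ : _ <= (1 - (8 * C1 / (M0 ^+ 2 * loglog n)
    + 16 / (M0 * (n%:R * delta_rate mstar n ^+ 2))))%:E)%E _.
    by rewrite lee_fin lerD2l lerN2.
  apply: le_trans (pw _) _.
    by apply: signal; rewrite /delta_rate mulr_ge0 ?powR_ge0.
  apply: le_measure; rewrite ?inE //.
    exact: mset (measurable_stat_tau _ _).
  move=> z /= tauz; apply: stat_adaptive_ge B0 _ Bthr tauz.
  by rewrite hmstar.
- apply: cvg_trans PE; apply: near_eq_cvg; near=> n.
  have Nn : (N <= n)%N by near: n; exact: nbhs_infty_ge.
  have [mZ PZ _] := ZP n; have [mE _] := tyE n Nn.
  rewrite Nn measureD //; last by rewrite (le_lt_trans (probability_le1 _ _)) ?ltry.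
  rewrite [X in (_ - X)%E](_ : _ = 0%E) ?sube0 //.
  by apply: (subset_measure0 _ mZ _ PZ); [exact: measurableI | exact: subIsetr].
Unshelve. all: by end_near. Qed.
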